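(* Let $\eta^{ij}$ and $\mu^{mn}$ be nondegenerate symmetric constant matrices of sizes $N\times N$ and $L\times L$, let $(\eta_{ij})$ be the inverse of $(\eta^{ij})$, and let functions $\psi_n(u)$, $1\le n\le L$, satisfy $$\sum_{m,n=1}^N \eta^{mn}\frac{\partial^2\psi_j}{\partial u^i\partial u^m}\frac{\partial^2\psi_k}{\partial u^n\partial u^l} = \sum_{m,n=1}^N \eta^{mn}\frac{\partial^2\psi_k}{\partial u^i\partial u^m}\frac{\partial^2\psi_j}{\partial u^n\partial u^l}\quad (1\le i,l\le N,\ 1\le j,k\le L),$$ $$\sum_{m,n=1}^L\mu^{mn}\frac{\partial^2\psi_m}{\partial u^i\partial u^j}\frac{\partial^2\psi_n}{\partial u^k\partial u^l} = \sum_{m,n=1}^L\mu^{mn}\frac{\partial^2\psi_m}{\partial u^i\partial u^k}\frac{\partial^2\psi_n}{\partial u^j\partial u^l}\quad(1\le i,j,k,l\le N).$$ Then, starting from $h_1(u)=\frac12\eta_{ij}u^iu^j$, the following recursion is always locally resolvable: for every $s\ge1$ and the corresponding function $h_s(u)$ there locally exist functions $F^{(s)}_n(u)$, $1\le n\le L$, such that $$\frac{\partial^2\psi_n}{\partial u^j\partial u^p}\,\eta^{jr}\,\frac{\partial h_s}{\partial u^r}=\frac{\partial F^{(s)}_n}{\partial u^p}\qquad(1\le p\le N),$$ and there locally exists a function $h_{s+1}(u)$ such that $$\sum_{m=1}^L\sum_{n=1}^L\mu^{mn}\frac{\partial^2\psi_m}{\partial u^j\partial u^k}F^{(s)}_n(u)=\frac{\partial^2h_{s+1}}{\partial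 u^j\partial u^k}\qquad(1\le j,k\le N).$$ Consequently, for every $s\ge1$ the flow $u^i_{t_s}=(R^s)^i_ju^j_x$ of the hierarchy generated by the recursion operator $R=M_1(M_2)^{-1}$ has the form of a local system of hydrodynamic type $$u^i_{t_s}=\sum_{m=1}^L\sum_{n=1}^L\mu^{mn}\eta^{ip}F^{(s)}_n(u)\frac{\partial^2\psi_m}{\partial u^p\partial u^k}u^k_x ,$$ all these flows commute and are bi-Hamiltonian, $$u^i_{t_s}=M_1^{ij}\frac{\delta H_s}{\delta u^j(x)}=M_2^{ij}\frac{\delta H_{s+1}}{\delta u^j(x)},\qquad H_s=\int h_s(u(x))\,dx,$$ and the functionals $H_s$ are in involution with respect to both Poisson brackets: $\{H_p,H_r\}_1=0$ and $\{H_p,H_r\}_2=0$ for all $p,r\ge1$.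
   Context: Here $u=(u^1,\dots,u^N)$ are local coordinates, $u^i(x)$ are fields depending on one variable $x$, repeated upper/lower indices are summed from $1$ to $N$, and all considerations are local. The operators are $$M^{ij}_1=\sum_{m=1}^L\sum_{n=1}^L\mu^{mn}\eta^{ip}\eta^{jr}\frac{\partial^2\psi_m}{\partial u^p\partial u^k}u^k_x\left(\frac{d}{dx}\right)^{-1}\circ\frac{\partial^2\psi_n}{\partial u^r\partial u^s}u^s_x,\qquad M_2^{ij}=\eta^{ij}\frac{d}{dx},$$ and the recursion operator is $$R^i_j=\sum_{m,n=1}^L\mu^{mn}\eta^{ip}\frac{\partial^2\psi_m}{\partial u^p\partial u^k}u^k_x\left(\frac{d}{dx}\right)^{-1}\circ\frac{\partial^2\psi_n}{\partial u^j\partial u^s}u^s_x\left(\frac{d}{dx}\right)^{-1}.$$ Antiderivatives $(d/dx)^{-1}$ of total $x$-derivatives of functions of $u$ are taken to be those functions (defined up to additive constants; the choices are those made in $F^{(s)}_n$ and $h_{s+1}$). The brackets are $\{I,J\}_a=\int\frac{\delta I}{\delta u^i(x)}M_a^{ij}\frac{\delta J}{\delta u^j(x)}dx$, $a=1,2$, with integrals of total $x$-derivatives equal to zero. Two flows commute if their mixed derivatives agree. *)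

(* Defs.v *)
From HB Require Import structures.
From mathcomp Require Import all_boot all_order all_algebra.
From mathcomp Require Import all_classical all_reals all_analysis.

Set Implicit Arguments.
Unset Strict Implicit.
Unset Printing Implicit Defensive.

Import Order.TTheory GRing.Theory Num.Theory.
Import numFieldNormedType.Exports.

Local Open Scope classical_set_scope.
Local Open Scope ring_scope.

Section PartialDerivatives.
Variable R : realType.

Definition pderiv (m n : nat) (f : 'M[R]_(m, n) -> R) (e : 'I_m * 'I_n) :
  'M[R]_(m, n) -> R := fun x => 'D_(delta_mx e.1 e.2) f x.

(* C^oo on the (open) set D; the values of f outside D are irrelevant. *)
Definition smooth_on (m n : nat) (D : set 'M[R]_(m, n)) (f : 'M[R]_(m, n) -> R)
    : Prop :=
  forall (es : seq ('I_m * 'I_n)) (x : 'M[R]_(m, n)), D x ->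
    {for x, continuous (foldl (@pderiv m n) f es)} /\
    forall e : 'I_m * 'I_n,
      derivable (foldl (@pderiv m n) f es) x (delta_mx e.1 e.2).

Definition partial (N : nat) (i : 'I_N) (f : 'rV[R]_N -> R) : 'rV[R]_N -> R :=
  pderiv f (ord0, i).

Definition partial2 (N : nat) (i j : 'I_N) (f : 'rV[R]_N -> R) : 'rV[R]_N -> R :=
  partial i (partial j f).

Definition locally_in (N : nat) (V : set 'rV[R]_N) (P : set 'rV[R]_N -> Prop)
    : Prop :=
  forall u0, V u0 -> exists W, [/\ open W, W u0, W `<=` V & P W].

End PartialDerivatives.

(* Formal variational calculus in one independent variable x. A point of the
   infinite jet space is a sequence z : nat -> 'rV_N, with z k standing for the
   k-th x-derivative of u; thus u = z 0 and u_x = z 1. *)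
Section JetCalculus.
Variables (R : realType) (N : nat).

Definition jet := nat -> 'rV[R]_N.

(* Smooth function of finitely many of u, u_x, u_xx, ..., defined for u in V. *)
Definition diff_fun (V : set 'rV[R]_N) (f : jet -> R) : Prop :=
  exists (k : nat) (phi : 'M[R]_(k.+1, N) -> R),
    smooth_on [set M | V (row ord0 M)] phi /\
    forall z : jet, V (z 0%N) -> f z = phi (\matrix_(a < k.+1, i < N) z a ord0 i).

Definition of_fields (f : 'rV[R]_N -> R) : jet -> R := fun z => f (z 0%N).

Definition ux (i : 'I_N) : jet -> R := fun z => z 1%N ord0 i.

Definition jet_shift (z : jet) (k : nat) (i : 'I_N) (t : R) : jet :=
  fun l => if l == k then z l + t *: delta_mx ord0 i else z l.

(* Partial derivative with respect to the i-th coordinate of the k-th jet. *)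
Definition djet (k : nat) (i : 'I_N) (f : jet -> R) : jet -> R :=
  fun z => derive1 (fun t : R => f (jet_shift z k i t)) 0.

(* The sums over all k : nat below are sums with finite support, since
   a differential function depends on finitely many jet coordinates. *)

(* d/dx *)
Definition Dx (f : jet -> R) : jet -> R := fun z =>
  \sum_(k \in [set: nat]) \sum_(i < N) z k.+1 ord0 i * djet k i f z.

(* delta I / delta u^i for I = int f dx *)
Definition vard (f : jet -> R) (i : 'I_N) : jet -> R := fun z =>
  \sum_(k \in [set: nat]) (-1) ^+ k * iter k Dx (djet k i f) z.

(* Derivative of f along the flow u^i_t = w i. *)
Definition evol (w : 'I_N -> jet -> R) (f : jet -> R) : jet -> R := fun z =>
  \sum_(k \in [set: nat]) \sum_(i < N) iter k Dx (w i) z * djet k i f z.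

(* u_t = v and u_t' = w satisfy (u_t)_t' = (u_t')_t. *)
Definition flows_commute (V : set 'rV[R]_N) (v w : 'I_N -> jet -> R) : Prop :=
  forall (i : 'I_N) (z : jet), V (z 0%N) -> evol w (v i) z = evol v (w i) z.

(* g is a choice of (d/dx)^{-1} f. *)
Definition antider (V : set 'rV[R]_N) (f g : jet -> R) : Prop :=
  diff_fun V g /\ forall z : jet, V (z 0%N) -> Dx g z = f z.

(* The functional int f dx is zero. *)
Definition null_functional (V : set 'rV[R]_N) (f : jet -> R) : Prop :=
  exists g, antider V f g.

(* K is a density of {int f dx, int g dx}, for the operator given by the
   relation M (M xi w meaning that w is the value of the operator on xi). *)
Definition bracket_density (V : set 'rV[R]_N)
    (M : ('I_N -> jet -> R) -> ('I_N -> jet -> R) -> Prop)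
    (f g K : jet -> R) : Prop :=
  exists w, M (vard g) w /\
    forall z : jet, V (z 0%N) -> K z = \sum_(i < N) vard f i z * w i z.

End JetCalculus.

Section Hierarchy.
Variables (R : realType) (N L : nat).
Variables (eta : 'M[R]_N) (mu : 'M[R]_L) (psi : 'I_L -> 'rV[R]_N -> R).
Variable V : set 'rV[R]_N.

Local Notation jetfun := (jet R N -> R).

(* The nonlocal operators are relations between arguments and values,
   parametrized by the antiderivatives A, G that are chosen for the
   occurrences of (d/dx)^{-1}. *)

(* w is M_1 xi, with G n the antiderivative of psi_{n,rs} u^s_x eta^{jr} xi_j. *)
Definition M1_rel (G : 'I_L -> jetfun) (xi w : 'I_N -> jetfun) : Prop :=
  (forall n : 'I_L,
     antider V
       (fun z => \sum_(j < N) \sum_(r < N) \sum_(s < N)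
          eta j r * partial2 r s (psi n) (z 0%N) * ux s z * xi j z)
       (G n)) /\
  (forall (i : 'I_N) (z : jet R N), V (z 0%N) ->
     w i z = \sum_(m < L) \sum_(n < L) \sum_(p < N) \sum_(k < N)
       mu m n * eta i p * partial2 p k (psi m) (z 0%N) * ux k z * G n z).

Definition M2_rel (xi w : 'I_N -> jetfun) : Prop :=
  forall (i : 'I_N) (z : jet R N), V (z 0%N) ->
    w i z = \sum_(j < N) eta i j * Dx (xi j) z.

(* w is R v, with A j the antiderivative of v^j and G n the antiderivative
   of psi_{n,js} u^s_x A^j. *)
Definition R_rel (A : 'I_N -> jetfun) (G : 'I_L -> jetfun)
    (v w : 'I_N -> jetfun) : Prop :=
  [/\ forall j : 'I_N, antider V (v j) (A j),
      forall n : 'I_L,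
        antider V
          (fun z => \sum_(j < N) \sum_(s < N)
             partial2 j s (psi n) (z 0%N) * ux s z * A j z)
          (G n)
    & forall (i : 'I_N) (z : jet R N), V (z 0%N) ->
        w i z = \sum_(m < L) \sum_(n < L) \sum_(p < N) \sum_(k < N)
          mu m n * eta i p * partial2 p k (psi m) (z 0%N) * ux k z * G n z].

(* w is R^s u_x; A t and G t are the antiderivatives chosen in the t-th
   application of R, 1 <= t <= s. *)
Fixpoint R_power (A : nat -> 'I_N -> jetfun) (G : nat -> 'I_L -> jetfun)
    (s : nat) (w : 'I_N -> jetfun) : Prop :=
  match s with
  | 0 => forall (i : 'I_N) (z : jet R N), V (z 0%N) -> w i z = ux i z
  | t.+1 => exists v, R_power A G t v /\ R_rel (A t.+1) (G t.+1) v w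
  end.

Definition F_step (h : 'rV[R]_N -> R) (F : 'I_L -> 'rV[R]_N -> R) : Prop :=
  forall (n : 'I_L) (p : 'I_N) (u : 'rV[R]_N), V u ->
    \sum_(j < N) \sum_(r < N) partial2 j p (psi n) u * eta j r * partial r h u
    = partial p (F n) u.

Definition h_step (F : 'I_L -> 'rV[R]_N -> R) (h : 'rV[R]_N -> R) : Prop :=
  forall (j k : 'I_N) (u : 'rV[R]_N), V u ->
    \sum_(m < L) \sum_(n < L) mu m n * partial2 j k (psi m) u * F n u
    = partial2 j k h u.

(* h s and F s are h_s and F^{(s)}; the values at s = 0 are not used. *)

Definition h_init (h : nat -> 'rV[R]_N -> R) : Prop :=
  forall u : 'rV[R]_N, V u ->
    h 1%N u = 2^-1 * \sum_(i < N) \sum_(j < N)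
                invmx eta i j * u ord0 i * u ord0 j.

Definition recursion_step (h : nat -> 'rV[R]_N -> R)
    (F : nat -> 'I_L -> 'rV[R]_N -> R) (s : nat) : Prop :=
  [/\ forall n, smooth_on V (F s n), F_step (h s) (F s),
      smooth_on V (h s.+1) & h_step (F s) (h s.+1)].

(* The recursion has been resolved on V up to h_s: the functions
   h_1, F^{(1)}, h_2, ..., F^{(s-1)}, h_s have been found. *)
Definition resolved_upto (s : nat) (h : nat -> 'rV[R]_N -> R)
    (F : nat -> 'I_L -> 'rV[R]_N -> R) : Prop :=
  h_init h /\ forall t, (1 <= t < s)%N -> recursion_step h F t.

Definition resolved (h : nat -> 'rV[R]_N -> R)
    (F : nat -> 'I_L -> 'rV[R]_N -> R) : Prop :=
  h_init h /\ forall t, (1 <= t)%N -> recursion_step h F t.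

(* The antiderivatives of the velocities and of the nonlocal terms of R that
   correspond to the choices of h_s and F^{(s)}; A_s^j = u^j for s = 1. *)
Definition A_of (h : nat -> 'rV[R]_N -> R) (s : nat) (j : 'I_N) : jetfun :=
  of_fields (fun u => \sum_(r < N) eta j r * partial r (h s) u).

Definition G_of (F : nat -> 'I_L -> 'rV[R]_N -> R) (s : nat) (n : 'I_L) : jetfun :=
  of_fields (F s n).

(* Right-hand side of the s-th local system of hydrodynamic type. *)
Definition flow (F : nat -> 'I_L -> 'rV[R]_N -> R) (s : nat) (i : 'I_N) : jetfun :=
  fun z => \sum_(m < L) \sum_(n < L) \sum_(p < N) \sum_(k < N)
    mu m n * eta i p * F s n (z 0%N) * partial2 p k (psi m) (z 0%N) * ux k z.

End Hierarchy.

(* Main.v *)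
Require Import Defs.
From HB Require Import structures.
From mathcomp Require Import all_boot all_order all_algebra.
From mathcomp Require Import all_classical all_reals all_analysis.
From mathcomp Require Import ring lra.

Set Implicit Arguments.
Unset Strict Implicit.
Unset Printing Implicit Defensive.

Import Order.TTheory GRing.Theory Num.Theory.
Import numFieldNormedType.Exports.

Local Open Scope classical_set_scope.
Local Open Scope ring_scope.

(* Write H(f) for the Hessian of f. The first family of equations says that the
   matrices H(psi_n) eta commute with one another, so H(psi_n) eta H(h) is
   symmetric for h = h_1 and for every h whose Hessian is a combination of the
   H(psi_m); this is the closedness of the forms defining F_n. The second family
   makes the derivatives of mu^{mn} psi_{m,jk} F_n totally symmetric, so two
   integrations give the next h. On a ball contained in the domain both
   integrations always succeed (Poincare lemma by integration along rays), so
   there the whole recursion can be resolved at once.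

   The s-th flow is u_t = D_x (eta grad h_(s+1)), with matrix eta H(h_(s+1));
   such flows commute because the matrices do. The antiderivatives that kill the
   brackets are explicit, hence exist on the whole domain: eta (dh_p, dh_r) and
   mu (F^(p), F^(r)) exhibit the skew-symmetry of the two brackets, and the
   Lenard scheme reduces {H_p, H_r}_2 to {H_(p+r-1), H_1}_2, the integral of
   D_x h_(p+r-1). *)

(** * Differential calculus on matrix spaces *)

(** Smoothness is given only through iterated coordinate partials. Symmetry of mixed derivatives,
    Frechet differentiability and the formula for directional derivatives therefore have to be
    obtained before a ray integral can be differentiated. The recursion leaves freedom at each step:
    locally, F^(s) is fixed up to constants and h_(s+1) up to an affine function. The argument
    carries an invariant that is insensitive to these choices: h_s is smooth and H(h_s) commutes,
    through eta, with every H(psi_n). Whatever constants were chosen, H(h_(s+1)) is a combination of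
    the H(psi_m) with functions as coefficients, and this alone restores the invariant. The nonlocal
    operators are relations between arguments, values and chosen antiderivatives. The equation for
    F^(s) says precisely that the nonlocal integrands are D_x F^(s)_n, so every antiderivative that
    occurs is a function of u alone, and each claim about flows and brackets becomes an identity
    between gradients and Hessians. *)

Section SmoothFunctions.
Variables (R : realType) (m n : nat).
Local Notation E := 'M[R]_(m, n).
Local Notation I := ('I_m * 'I_n)%type.
Implicit Types (D : set E) (f g : E -> R) (e : I) (es : seq I).

(** Graded form of [smooth_on], made for induction on the order. Level k asks the partials of order
    k to have partials themselves, so [is_Ck 0] is already more than continuity. *)
Definition is_Ck (k : nat) (D : set E) (f : E -> R) : Prop :=
  forall es x, (size es <= k)%N -> D x ->
    {for x, continuous (foldl (@pderiv R m n) f es)} /\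
    forall e, derivable (foldl (@pderiv R m n) f es) x (delta_mx e.1 e.2).

Lemma smooth_onP D f : smooth_on D f <-> forall k, is_Ck k D f.
Proof.
split=> [sf k es x _|Cf es x]; first exact: sf.
exact: Cf (leqnn (size es)).
Qed.

Lemma is_CkS k D f :
  is_Ck k.+1 D f <-> is_Ck 0 D f /\ forall e, is_Ck k D (pderiv f e).
Proof.
split=> [Cf|[C0 Cf]].
  split=> [[|//] x _|e es x ek]; first exact: Cf.
  exact: (Cf (e :: es)).
by move=> [|e es] x ek Dx; [exact: (C0 [::])|exact: (Cf e es)].
Qed.

Lemma is_Ck_continuous k D f x : is_Ck k D f -> D x -> {for x, continuous f}.
Proof. by move=> Cf Dx; have [] := Cf [::] x isT Dx. Qed.

Lemma is_Ck_derivable k D f x e :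
  is_Ck k D f -> D x -> derivable f x (delta_mx e.1 e.2).
Proof. by move=> Cf Dx; have [_] := Cf [::] x isT Dx; exact. Qed.

Lemma is_Ck0 D f :
  (forall x, D x -> {for x, continuous f}) ->
  (forall x e, D x -> derivable f x (delta_mx e.1 e.2)) -> is_Ck 0 D f.
Proof.
by move=> cf df [|//] x _ Dx; split=> [|e]; [exact: cf|exact: df].
Qed.

Lemma is_Ck_leq k l D f : (k <= l)%N -> is_Ck l D f -> is_Ck k D f.
Proof. by move=> kl Cf es x ek; exact/Cf/(leq_trans ek). Qed.

Lemma pderiv_eq D f g x e : open D -> {in D, f =1 g} -> D x ->
  pderiv f e x = pderiv g e x.
Proof.
move=> oD fg Dx; apply: near_eq_derive.
have := open_nbhs_nbhs (conj oD Dx); apply: filterS => y Dy.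
by apply: fg; rewrite inE.
Qed.

Lemma is_Ck_eq k D f g : open D -> {in D, f =1 g} -> is_Ck k D f -> is_Ck k D g.
Proof.
move=> oD; have C0_eq f1 g1 : {in D, f1 =1 g1} -> is_Ck 0 D f1 -> is_Ck 0 D g1.
  move=> fg Cf.
  have nfg x : D x -> \forall y \near x, f1 y = g1 y.
    move=> Dx; have := open_nbhs_nbhs (conj oD Dx); apply: filterS => y Dy.
    by apply: fg; rewrite inE.
  apply: is_Ck0 => [x Dx|x e Dx].
    rewrite /prop_for /continuous_at -fg ?inE//.
    exact: cvg_trans (near_eq_cvg (nfg x Dx)) (is_Ck_continuous Cf Dx).
  by apply: (near_eq_derivable _ (is_Ck_derivable Cf Dx)); exact: nfg.
elim: k f g => [|k IH] f g fg; first exact: (C0_eq _ _ fg).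
move=> /is_CkS[C0 C1]; apply/is_CkS; split; first exact: (C0_eq _ _ fg C0).
by move=> e; apply: IH (C1 e) => x; rewrite inE => Dx; exact: (pderiv_eq _ oD fg Dx).
Qed.

Lemma is_CkD k D f g : open D -> is_Ck k D f -> is_Ck k D g -> is_Ck k D (f + g).
Proof.
move=> oD; elim: k f g => [|k IH] f g Cf Cg.
  apply: is_Ck0 => [x Dx|x e Dx].
    exact: continuousD (is_Ck_continuous Cf Dx) (is_Ck_continuous Cg Dx).
  exact: derivableD (is_Ck_derivable Cf Dx) (is_Ck_derivable Cg Dx).
have C0 h : is_Ck k.+1 D h -> is_Ck 0 D h by exact: is_Ck_leq.
apply/is_CkS; split.
  apply: is_Ck0 => [x Dx|x e Dx].
    exact: continuousD (is_Ck_continuous Cf Dx) (is_Ck_continuous Cg Dx).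
  exact: derivableD (is_Ck_derivable Cf Dx) (is_Ck_derivable Cg Dx).
move=> e; apply: (@is_Ck_eq _ _ (pderiv f e + pderiv g e)) => //.
  move=> x; rewrite inE => Dx; rewrite /pderiv deriveD//.
    exact: is_Ck_derivable Cf Dx.
  exact: is_Ck_derivable Cg Dx.
by apply: IH; [have [_] := (is_CkS _ _ _).1 Cf|have [_] := (is_CkS _ _ _).1 Cg].
Qed.

Lemma is_CkM k D f g : open D -> is_Ck k D f -> is_Ck k D g -> is_Ck k D (f * g).
Proof.
move=> oD; elim: k f g => [|k IH] f g Cf Cg.
  apply: is_Ck0 => [x Dx|x e Dx].
    exact: continuousM (is_Ck_continuous Cf Dx) (is_Ck_continuous Cg Dx).
  exact: derivableM (is_Ck_derivable Cf Dx) (is_Ck_derivable Cg Dx).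
apply/is_CkS; split.
  apply: is_Ck0 => [x Dx|x e Dx].
    exact: continuousM (is_Ck_continuous Cf Dx) (is_Ck_continuous Cg Dx).
  exact: derivableM (is_Ck_derivable Cf Dx) (is_Ck_derivable Cg Dx).
move=> e; apply: (@is_Ck_eq _ _ (f * pderiv g e + g * pderiv f e)) => //.
  move=> x; rewrite inE => Dx; rewrite /pderiv deriveM//.
    exact: is_Ck_derivable Cf Dx.
  exact: is_Ck_derivable Cg Dx.
have [_ Cf'] := (is_CkS _ _ _).1 Cf; have [_ Cg'] := (is_CkS _ _ _).1 Cg.
by apply: is_CkD => //; apply: IH => //; exact: is_Ck_leq (leqnSn k) _.
Qed.

Lemma smooth_on_continuous D f x : smooth_on D f -> D x -> {for x, continuous f}.
Proof. by move=> sf Dx; have [] := sf [::] x Dx. Qed.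

Lemma smooth_on_derivable D f x e :
  smooth_on D f -> D x -> derivable f x (delta_mx e.1 e.2).
Proof. by move=> sf Dx; have [_] := sf [::] x Dx; exact. Qed.

Lemma smooth_on_pderiv D f e : smooth_on D f -> smooth_on D (pderiv f e).
Proof. by move=> sf es; exact: (sf (e :: es)). Qed.

Lemma smooth_onW D D' f : D' `<=` D -> smooth_on D f -> smooth_on D' f.
Proof. by move=> DD' sf es x /DD'; exact: sf. Qed.

Lemma smooth_on_eq D f g : open D -> {in D, f =1 g} ->
  smooth_on D f -> smooth_on D g.
Proof.
by move=> oD fg /smooth_onP sf; apply/smooth_onP => k; exact: is_Ck_eq (sf k).
Qed.

Lemma smooth_onD D f g : open D ->
  smooth_on D f -> smooth_on D g -> smooth_on D (f + g).
Proof.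
move=> oD /smooth_onP sf /smooth_onP sg; apply/smooth_onP => k.
exact: is_CkD.
Qed.

Lemma smooth_onM D f g : open D ->
  smooth_on D f -> smooth_on D g -> smooth_on D (f * g).
Proof.
move=> oD /smooth_onP sf /smooth_onP sg; apply/smooth_onP => k.
exact: is_CkM.
Qed.

(** Bootstrap: smooth first partials give partials of every order. Continuity of f is asked
    separately because the mere existence of partials does not imply it; [smooth_on_of_partials]
    supplies it later. *)
Lemma smooth_on_primitive D f (P : I -> E -> R) : open D ->
  (forall x, D x -> {for x, continuous f}) ->
  (forall x e, D x -> is_derive x (delta_mx e.1 e.2) f (P e x)) ->
  (forall e, smooth_on D (P e)) -> smooth_on D f.
Proof.
move=> oD cf df sP.
have dfe x e : D x -> derivable f x (delta_mx e.1 e.2) by move=> /df -/(_ e)[].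
have C0 : is_Ck 0 D f by exact: is_Ck0.
apply/smooth_onP => -[//|k]; apply/is_CkS; split => // e.
apply: (@is_Ck_eq _ _ (P e)) => //; last by have /smooth_onP := sP e.
by move=> x; rewrite inE => Dx; have [_ <-] := df x e Dx.
Qed.

Lemma smooth_on_cst D c : open D -> smooth_on D (cst c).
Proof.
move=> oD.
(* Zero reproduces itself under differentiation, hence the induction; any constant is then a
   primitive of zero. *)
have C0 k : is_Ck k D (cst 0).
  elim: k => [|k IH]; first by apply: is_Ck0 => *; [exact: cst_continuous|].
  apply/is_CkS; split; first by apply: is_Ck0 => *; [exact: cst_continuous|].
  by move=> e; apply: is_Ck_eq IH => // x _; rewrite /pderiv derive_cst.
apply: (@smooth_on_primitive _ _ (fun=> cst 0)) => //.
- by move=> x _; exact: cst_continuous.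
- by move=> e; apply/smooth_onP.
Qed.

Lemma smooth_onZ D c f : open D -> smooth_on D f -> smooth_on D (fun x => c * f x).
Proof. by move=> oD sf; exact: (smooth_onM oD (smooth_on_cst c oD) sf). Qed.

Lemma smooth_on_sum D (J : finType) (F : J -> E -> R) : open D ->
  (forall j, smooth_on D (F j)) -> smooth_on D (fun x => \sum_j F j x).
Proof.
move=> oD sF.
have -> : (fun x => \sum_j F j x) = \sum_j F j.
  by apply/funext => x; rewrite fct_sumE.
elim/big_ind : _ => [|f g sf sg|j _]; first exact: (smooth_on_cst 0 oD).
  exact: (smooth_onD oD sf sg).
exact: sF.
Qed.

Lemma is_derive_coord (x v : E) i j : is_derive x v (fun y : E => y i j) (v i j).
Proof.
apply: DeriveDef; first exact: diff_derivable (differentiable_coord x i j).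
apply: cvg_lim => //; apply: (cvg_trans _ (cvg_cst (v i j))).
apply: near_eq_cvg; near=> h.
have h0 : h != 0 by near: h; exact: nbhs_dnbhs_neq.
by rewrite /= !mxE addrK /GRing.scale/= mulKf.
exact: dnbhs_filter.
Unshelve. all: by end_near. Qed.

Lemma smooth_on_coord D i j : open D -> smooth_on D (fun x : E => x i j).
Proof.
move=> oD; have cE x : {for x, continuous (fun y : E => y i j)}.
  exact: coord_continuous.
apply: (smooth_on_primitive oD (fun x _ => cE x)
  (fun x e _ => is_derive_coord x (delta_mx e.1 e.2) i j)).
by move=> e; exact: smooth_on_cst.
Qed.

End SmoothFunctions.

(** * Mean value theorem along lines and symmetry of second derivatives *)

Section AlongLines.
Variables (R : realType) (E : normedModType R).
Implicit Types (f : E -> R) (y v : E) (a : R).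

Lemma is_derive_line f y v a : derivable f (y + a *: v) v ->
  is_derive a 1 (fun s => f (y + s *: v)) ('D_v f (y + a *: v)).
Proof.
have lineE : (fun h : R => h^-1 *: (((fun s => f (y + s *: v)) \o shift a) (h *: 1)
    - f (y + a *: v))) =
  (fun h => h^-1 *: ((f \o shift (y + a *: v)) (h *: v) - f (y + a *: v))).
  apply/funext => h /=; congr (_ *: (f _ - _)).
  have -> : h *: (1 : R^o) = h by exact: mulr1.
  by rewrite scalerDl addrCA.
by move=> df; apply: DeriveDef; rewrite /derivable /derive lineE.
Qed.

(** Absolute values let one statement serve both signs of [a]: the coordinates of an increment have
    no prescribed sign. *)
Lemma MVT_line f y v a : (forall c : R, `|c| <= `|a| -> derivable f (y + c *: v) v) ->
  exists2 c : R, `|c| <= `|a| & f (y + a *: v) - f y = a * 'D_v f (y + c *: v).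
Proof.
move=> df; pose g (s : R) := f (y + s *: v).
have g0 : g 0 = f y by rewrite /g scale0r addr0.
have dg (c : R) : `|c| <= `|a| -> is_derive c 1 g ('D_v f (y + c *: v)).
  by move=> ca; exact/is_derive_line/df.
have [a0|a0] := leP 0 a.
  have itv (c : R) : c \in `[0, a] -> `|c| <= `|a|.
    by rewrite in_itv/= => /andP[c0 ca]; rewrite !ger0_norm.
  have [c cI|z zI|c cI gE] := @MVT_segment _ g (fun c => 'D_v f (y + c *: v)) _ _ a0.
  - by apply/dg/itv; exact: subset_itv_oo_cc.
  - by apply: derivable_within_continuous zI => z' /itv /dg[].
  - by exists c; [exact: itv|rewrite -g0 -/(g a) gE subr0 mulrC].
have itv (c : R) : c \in `[a, 0] -> `|c| <= `|a|.
  rewrite in_itv/= => /andP[c0 ca]; rewrite ler0_norm// ltr0_norm//.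
  by rewrite lerN2.
have [c cI|z zI|c cI gE] := @MVT_segment _ g (fun c => 'D_v f (y + c *: v)) _ _ (ltW a0).
- by apply/dg/itv; exact: subset_itv_oo_cc.
- by apply: derivable_within_continuous zI => z' /itv /dg[].
- exists c; first exact: itv.
  by rewrite -g0 -/(g a) -opprB gE sub0r mulrN opprK mulrC.
Qed.

End AlongLines.

Lemma ler_dist_near (R : realType) (eps p q a b : R) : a = b ->
  `|p - a| < eps / 2 -> `|q - b| < eps / 2 -> `|p - q| <= eps.
Proof.
move=> <-; rewrite !ltr_distl ler_distl => /andP[p1 p2] /andP[q1 q2].
by apply/andP; split; lra.
Qed.

Section C1Functions.
Variables (R : realType) (m n : nat).
Local Notation E := 'M[R]_(m, n).
Local Notation I := ('I_m * 'I_n)%type.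
Local Notation dlt e := (delta_mx e.1 e.2 : E).
Implicit Types (f : E -> R) (e : I).

Lemma mx_norm_coord (h : E) e : `|h e.1 e.2| <= `|h|.
Proof. by rewrite [leRHS]/Num.Def.normr/= mx_normrE; exact: (le_bigmax _ _ e). Qed.

Lemma mx_norm_delta e : `|dlt e| <= 1.
Proof.
rewrite [leLHS]/Num.Def.normr/= mx_normrE (bigmax_le _ ler01)//= => -[i j] _.
by rewrite mxE/=; case: (_ && _); rewrite ?normr1 ?normr0 ?ler01.
Qed.

Lemma matrix_sum_pairs (h : E) : h = \sum_e h e.1 e.2 *: dlt e.
Proof.
rewrite [LHS]matrix_sum_delta pair_bigA /=.
by apply: eq_bigr => -[].
Qed.

(** Two mean value theorems turn a second difference of step s into s^2 times a mixed derivative at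
    some point near x, one point for each order of differentiation. Continuity puts these two equal
    values within eps / 2 of the two values at x. The step d / 3 is small enough for two moves to
    stay within d. *)
Lemma schwarz f x e1 e2 (D : set E) : open D -> smooth_on D f -> D x ->
  pderiv (pderiv f e1) e2 x = pderiv (pderiv f e2) e1 x.
Proof.
move=> oD sf Dx; apply/eqP; rewrite -subr_eq0 -normr_le0.
apply/ler_addgt0Pl => /= eps eps0; rewrite addr0.
have c1 := smooth_on_continuous (smooth_on_pderiv e2 (smooth_on_pderiv e1 sf)) Dx.
have c2 := smooth_on_continuous (smooth_on_pderiv e1 (smooth_on_pderiv e2 sf)) Dx.
have e20 : 0 < eps / 2 by rewrite divr_gt0.
have [d d0 dP] : exists2 d : R, 0 < d & forall y : E, `|x - y| < d -> [/\ D y,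
    `|pderiv (pderiv f e1) e2 x - pderiv (pderiv f e1) e2 y| < eps / 2 &
    `|pderiv (pderiv f e2) e1 x - pderiv (pderiv f e2) e1 y| < eps / 2].
  have N : \forall y \near x, [/\ D y,
    `|pderiv (pderiv f e1) e2 x - pderiv (pderiv f e1) e2 y| < eps / 2 &
    `|pderiv (pderiv f e2) e1 x - pderiv (pderiv f e2) e1 y| < eps / 2].
    have /cvgrPdist_lt/(_ _ e20) n1 := c1.
    have /cvgrPdist_lt/(_ _ e20) n2 := c2.
    have nD := open_nbhs_nbhs (conj oD Dx).
    apply: filterS3 nD n1 n2 => y Dy y1 y2; exact: And3 Dy y1 y2.
  move/nbhs_ballP : N => [d /= d0 dP]; exists d => // y xy.
  by apply: dP; rewrite -ball_normE.
(* second difference over the square of side s, evaluated in both orders *)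
pose s := d / 3; have s0 : 0 < s by rewrite divr_gt0.
have near_sq (a b : R) (u v : I) : `|a| <= `|s| -> `|b| <= `|s| ->
    `|x - (x + a *: dlt u + b *: dlt v)| < d.
  rewrite (gtr0_norm s0) => ha hb; rewrite -addrA opprD addNKr normrN.
  apply: (le_lt_trans (ler_normD _ _)); rewrite !normrZ.
  apply: (@le_lt_trans _ _ (s + s)).
    by apply: lerD; rewrite -[leRHS]mulr1 ler_pM// mx_norm_delta.
  by rewrite /s; lra.
have sq (u v : I) : exists2 y : E, `|x - y| < d & 
    f (x + s *: dlt u + s *: dlt v) - f (x + s *: dlt u)
    - (f (x + s *: dlt v) - f x) = s * (s * pderiv (pderiv f u) v y).
  (* The derivative of g in direction u is a difference of [pderiv f u] in direction v, ready for
     the second mean value theorem. *)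
  pose g (y : E) :=  f (y + s *: dlt v) - f y.
  have dgx (y : E) : `|x - y| < d -> `|x - (y + s *: dlt v)| < d ->
      is_derive y (dlt u) g (pderiv f u (y + s *: dlt v) - pderiv f u y).
    move=> /dP[Dy _ _] /dP[Dys _ _].
    apply: is_deriveB; last first.
      by apply: derivableP; exact: smooth_on_derivable Dy.
    have dfs := smooth_on_derivable sf Dys (e := u).
    have shE : (fun h : R => h^-1 *: (((fun z => f (z + s *: dlt v)) \o shift y)
        (h *: dlt u) - f (y + s *: dlt v))) = (fun h : R => h^-1 *:
        ((f \o shift (y + s *: dlt v)) (h *: dlt u) - f (y + s *: dlt v))).
      by apply/funext => h /=; rewrite addrA.
    by apply: DeriveDef; rewrite /derivable /derive /pderiv shE.
  have [c cs|c cs gE] := @MVT_line R E g x (dlt u) s.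
    have := near_sq c s u v cs (lexx _); have := near_sq c 0 u v cs.
    rewrite normr0 scale0r addr0 => /(_ (normr_ge0 _)) h1 h2.
    by case: (dgx _ h1 h2).
  have h2 := near_sq c s u v cs (lexx _); have := near_sq c 0 u v cs.
  rewrite normr0 scale0r addr0 => /(_ (normr_ge0 _)) h1.
  have [b bs|b bs fE] := @MVT_line R E (pderiv f u) (x + c *: dlt u) (dlt v) s.
    have /dP[Dy _ _] := near_sq c b u v cs bs.
    by apply: smooth_on_derivable Dy; exact: smooth_on_pderiv.
  exists (x + c *: dlt u + b *: dlt v); first exact: near_sq.
  have -> : f (x + s *: dlt u + s *: dlt v) - f (x + s *: dlt u)
    - (f (x + s *: dlt v) - f x) = g (x + s *: dlt u) - g x by [].
  rewrite gE; congr (_ * _).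
  by have [_ ->] := dgx _ h1 h2; rewrite fE.
have [y1 /dP[_ y1d _] y1E] := sq e1 e2.
have [y2 /dP[_ _ y2d] y2E] := sq e2 e1.
have y12 : pderiv (pderiv f e1) e2 y1 = pderiv (pderiv f e2) e1 y2.
  have sw : x + s *: dlt e1 + s *: dlt e2 = x + s *: dlt e2 + s *: dlt e1.
    exact: addrAC.
  have fsw := congr1 f sw.
  have swap (a a' b c w p q : R) : a = a' -> a - b - (c - w) = s * (s * p) ->
      a' - c - (b - w) = s * (s * q) -> p = q.
    move=> -> ap aq; apply: (mulfI (lt0r_neq0 s0)); apply: (mulfI (lt0r_neq0 s0)).
    by rewrite -ap -aq; ring.
  exact (swap _ _ _ _ _ _ _ fsw y1E y2E).
exact (ler_dist_near y12 y1d y2d).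
Qed.

End C1Functions.

(** * Frechet differentiability from continuous partials *)

Section Differentiability.
Variables (R : realType) (m n : nat).
Local Notation E := 'M[R]_(m, n).
Local Notation I := ('I_m * 'I_n)%type.
Local Notation dlt e := (delta_mx e.1 e.2 : E).
Implicit Types (f : E -> R) (e : I) (D : set E).

Lemma mx_norm_partial_sum (h : E) (s : seq I) :
  `|\sum_(e <- s) h e.1 e.2 *: dlt e| <= (size s)%:R * `|h|.
Proof.
elim: s => [|e s IH]; first by rewrite big_nil normr0 mul0r.
rewrite big_cons; apply: (le_trans (ler_normD _ _)).
rewrite -[X in _ <= X]/((size s).+1%:R * `|h|) -natr1 addrC mulrDl mul1r.
by apply: lerD => //; rewrite normrZ -[leRHS]mulr1 ler_pM ?mx_norm_coord ?mx_norm_delta.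
Qed.

Lemma partials_near D f x (eps : R) : open D ->
  (forall e, {for x, continuous (pderiv f e)}) -> D x -> 0 < eps ->
  exists2 d : R, 0 < d & forall y : E, `|x - y| < d ->
    D y /\ forall e, `|pderiv f e x - pderiv f e y| <= eps.
Proof.
move=> oD cf Dx eps0.
have nD := open_nbhs_nbhs (conj oD Dx).
have nfe e : \forall y \near x, `|pderiv f e x - pderiv f e y| <= eps.
  by have /cvgrPdist_le/(_ _ eps0) := cf e.
have nf := @filter_forall E _ _ (nbhs x) (nbhs_filter x) nfe.
have /nbhs_ballP nI := @filterI E _ (nbhs_filter x) _ _ nD nf.
have [d /= d0 dP] := nI.
exists d => // y xy; apply: dP.
by rewrite -ball_normE.
Qed.

(** Telescoping: the coordinates are changed one at a time, the mean value theorem handles each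
    move, and each move costs at most eps / K times the norm of h. *)
Lemma taylor_of_partials D f x (eps : R) : open D ->
  (forall y e, D y -> derivable f y (dlt e)) ->
  (forall e, {for x, continuous (pderiv f e)}) -> D x -> 0 < eps ->
  exists2 d : R, 0 < d & forall h : E, `|h| < d ->
    `|f (x + h) - f x - \sum_e h e.1 e.2 * pderiv f e x| <= eps * `|h|.
Proof.
move=> oD df cf Dx eps0.
(* One more than the number of coordinates, so that division by K makes sense for empty matrices
   too; the radius d / K keeps all partial sums of the increment within d. *)
pose K : R := #|{: I}|%:R + 1.
have K0 : 0 < K by rewrite ltr_wpDl ?ler0n.
have eK0 : 0 < eps / K by rewrite divr_gt0.
have [d d0 dP] := partials_near oD cf Dx eK0.
exists (d / K) => [|h]; first by rewrite divr_gt0.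
rewrite ltr_pdivlMr// => hd.
have KN : #|{: I}|%:R <= K by rewrite lerDl.
pose hs (s : seq I) : E := \sum_(e <- s) h e.1 e.2 *: dlt e.
have step (s : seq I) : (size s <= #|{: I}|)%N ->
    `|f (x + hs s) - f x - \sum_(e <- s) h e.1 e.2 * pderiv f e x|
    <= (size s)%:R * (eps / K * `|h|).
  elim: s => [|e s IH] ss; first by rewrite /hs !big_nil addr0 subrr subr0 normr0 mul0r.
  have close (c : R) : `|c| <= `|h e.1 e.2| -> `|x - (x + hs s + c *: dlt e)| < d.
    move=> ch; rewrite -addrA opprD addNKr normrN; apply: le_lt_trans hd.
    apply: (le_trans (ler_normD _ _)).
    apply: (@le_trans _ _ ((size s).+1%:R * `|h|)); last first.
      rewrite mulrC ler_wpM2l//; apply: le_trans KN; by rewrite ler_nat.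
    rewrite -natr1 mulrDl mul1r lerD ?mx_norm_partial_sum//.
    rewrite normrZ -[leRHS]mulr1 ler_pM ?mx_norm_delta//.
    exact: le_trans ch (mx_norm_coord _ _).
  have [c /close/dP[Dy _]|c ch fE] := @MVT_line R E f (x + hs s) (dlt e) (h e.1 e.2).
    exact: df.
  have [_ /(_ e) pe] := dP _ (close _ ch).
  have IHs := IH (ltnW ss).
  have -> : hs (e :: s) = hs s + h e.1 e.2 *: dlt e by rewrite /hs big_cons addrC.
  rewrite addrA big_cons -[size (e :: s)]/(size s).+1 -natr1 mulrDl mul1r.
  set y := x + hs s + c *: dlt e in fE pe.
  have -> : f (x + hs s + h e.1 e.2 *: dlt e) - f x -
      (h e.1 e.2 * pderiv f e x + \sum_(j <- s) h j.1 j.2 * pderiv f j x) =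
      (f (x + hs s) - f x - \sum_(j <- s) h j.1 j.2 * pderiv f j x)
      - h e.1 e.2 * (pderiv f e x - pderiv f e y).
    rewrite [pderiv f e y]/pderiv mulrBr -fE.
    by move: (f _) (f (x + hs s)) (\sum_(_ <- _) _) (h _ _ * _) => a b u v; ring.
  apply: (le_trans (ler_normB _ _)); apply: lerD => //.
  by rewrite normrM mulrC ler_pM// mx_norm_coord.
have := step (enum {: I}); rewrite -cardE leqnn => /(_ isT).
rewrite /hs !big_enum/= -matrix_sum_pairs => hle; apply: (le_trans hle).
have -> : #|{: I}|%:R * (eps / K * `|h|) = #|{: I}|%:R / K * (eps * `|h|).
  by rewrite -!mulrA; congr (_ * _); rewrite mulrCA.
apply: ler_piMl; first by rewrite mulr_ge0// ltW.
by rewrite ler_pdivrMr// mul1r.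
Qed.

Lemma coord_combination_continuous (c : I -> R) :
  continuous (fun h : E => \sum_e h e.1 e.2 * c e).
Proof.
have oT := @openT E; move=> h; apply: (@smooth_on_continuous _ _ _ setT) => //.
apply: smooth_on_sum => // e.
exact: (smooth_onM oT (smooth_on_coord e.1 e.2 oT) (smooth_on_cst (c e) oT)).
Qed.

Lemma differentiable_of_partials D f x : open D ->
  (forall y e, D y -> derivable f y (dlt e)) ->
  (forall e, {for x, continuous (pderiv f e)}) -> D x -> differentiable f x.
Proof.
move=> oD der_f cf Dx; pose df (h : E) : R := \sum_e h e.1 e.2 * pderiv f e x.
have df_lin : linear df.
  move=> a u v; rewrite /df scaler_sumr -big_split/=; apply: eq_bigr => e _.
  by rewrite !mxE mulrDl -mulrA.
pose dfM := GRing.isLinear.Build _ _ _ _ df df_lin.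
pose dfL : {linear E -> R} := HB.pack df dfM.
have df_cont : continuous dfL by exact: coord_combination_continuous.
have taylor (eps : {posnum R}) : \forall h \near (0 : E),
    `|f (x + h) - f x - df h| <= eps%:num * `|h|.
  have [d d0 dP] := taylor_of_partials oD der_f cf Dx (gt0 eps).
  apply/nbhs_ballP; exists d => // h; rewrite -ball_normE/= sub0r normrN => hd.
  exact: dP.
have shiftE h : (f \o shift x - (cst (f x) + dfL)) h = f (x + h) - f x - df h.
  by rewrite !fctE/= (addrC h) opprD addrA.
(* The Taylor estimate serves twice: here it identifies the differential, afterwards it gives the
   expansion required by differentiability. *)
have dE : 'd f x = dfL :> (E -> R).
  apply: (@diff_unique _ E R f dfL x df_cont).
  apply/eqaddoP => _/posnumP[eps]; apply: filterS (taylor eps) => h.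
  by rewrite shiftE.
apply/diff_locallyP; rewrite dE; split => //.
apply/eqaddoP => _/posnumP[eps]; apply: filterS (taylor eps) => h.
by rewrite shiftE.
Qed.

Lemma is_C1_differentiable D f x : open D -> is_Ck 1 D f -> D x ->
  differentiable f x.
Proof.
move=> oD Cf Dx; apply: (differentiable_of_partials oD) => // [y e Dy|e].
  exact: is_Ck_derivable Cf Dy.
have [_ /(_ e) C0] := (is_CkS _ _ _).1 Cf.
exact: is_Ck_continuous C0 Dx.
Qed.

Lemma derive_is_C1 D f x v : open D -> is_Ck 1 D f -> D x ->
  'D_v f x = \sum_e v e.1 e.2 * pderiv f e x.
Proof.
move=> oD Cf Dx; have dfx := is_C1_differentiable oD Cf Dx.
rewrite deriveE// {1}(matrix_sum_pairs v) linear_sum; apply: eq_bigr => e _.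
by rewrite linearZ -deriveE.
Qed.

(** The partials are continuous, so f is Frechet differentiable and hence continuous, as
    [smooth_on_primitive] demands. *)
Lemma smooth_on_of_partials D f (P : I -> E -> R) : open D ->
  (forall x e, D x -> is_derive x (dlt e) f (P e x)) ->
  (forall e, smooth_on D (P e)) -> smooth_on D f.
Proof.
move=> oD df sP; apply: (smooth_on_primitive oD _ df sP) => x Dx.
apply: differentiable_continuous.
apply: (differentiable_of_partials oD) => // [y e Dy|e]; first by case: (df y e Dy).
have cP := smooth_on_continuous (sP e) Dx.
have fP y : D y -> pderiv f e y = P e y by move=> Dy; case: (df y e Dy).
have nfP : \forall y \near x, P e y = pderiv f e y.
  by have := open_nbhs_nbhs (conj oD Dx); apply: filterS => y /fP.
rewrite /prop_for /continuous_at fP//; exact: cvg_trans (near_eq_cvg nfP) cP.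
Qed.

End Differentiability.

(** * The Poincare lemma *)

Section FiniteSums.
Variable R : realType.

Lemma continuous_at_sum (T : topologicalType) (J : finType) (F : J -> T -> R) x :
  (forall j, {for x, continuous (F j)}) ->
  {for x, continuous (fun y => \sum_j F j y)}.
Proof.
move=> cF; have -> : (fun y => \sum_j F j y) = \sum_j F j.
  by apply/funext => y; rewrite fct_sumE.
elim/big_ind : _ => [|f g cf cg|j _]; first exact: cst_continuous.
  exact: (continuousD cf cg).
exact: cF.
Qed.

Lemma is_derive_fct_sum (E : normedModType R) (J : finType) (F : J -> E -> R)
    (dF : J -> R) x v :
  (forall j, is_derive x v (F j) (dF j)) ->
  is_derive x v (fun y => \sum_j F j y) (\sum_j dF j).
Proof.
move=> dFj; have -> : (fun y => \sum_j F j y) = \sum_j F j.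
  by apply/funext => y; rewrite fct_sumE.
elim/big_ind2 : _ => [|f df g dg ? ?|j _]; first exact: is_derive_cst.
  exact: is_deriveD.
exact: dFj.
Qed.

Lemma is_derive_fct_mul (E : normedModType R) (f g : E -> R) x v (df dg : R) :
  is_derive x v f df -> is_derive x v g dg ->
  is_derive x v (fun y => f y * g y) (f x * dg + g x * df).
Proof. by move=> dfx dgx; exact: (is_deriveM dfx dgx). Qed.

End FiniteSums.

Section PoincareLemma.
Variables (R : realType) (m n : nat).
Local Notation E := 'M[R]_(m, n).
Local Notation I := ('I_m * 'I_n)%type.
Local Notation dlt e := (delta_mx e.1 e.2 : E).
Local Notation mu := (@lebesgue_measure R).
Variables (D : set E) (u0 : E) (P : I -> E -> R).
Hypothesis oD : open D.
Hypothesis star : forall (u : E) (t : R), D u -> 0 <= t <= 1 ->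
  D (u0 + t *: (u - u0)).
Hypothesis C1P : forall e, is_Ck 1 D (P e).
Hypothesis closedP : forall e1 e2 x, D x ->
  pderiv (P e1) e2 x = pderiv (P e2) e1 x.

Let ray (u : E) (t : R) : E := u0 + t *: (u - u0).

Let integrand (u : E) (t : R) : R :=
  \sum_e (u - u0) e.1 e.2 * P e (ray u t).

(** The classical homotopy operator: the line integral of the form P along the segment from u0 to
    u. *)
Definition ray_primitive (u : E) : R :=
  \int[mu]_(t in `[0%R, 1%R]) integrand u t.

(** The derivative of [integrand] in the p-th coordinate of u. The first term comes from the factor
    u - u0; in the second, moving u by h moves the point of the ray by t h, whence the factor t. *)
Let dintegrand (p : I) (u : E) (t : R) : R :=
  P p (ray u t) + t * \sum_e (u - u0) e.1 e.2 * pderiv (P e) p (ray u t).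

Lemma is_derive_ray_integrand p u t : D (ray u t) ->
  is_derive u (dlt p) (integrand ^~ t) (dintegrand p u t).
Proof.
move=> Dr; rewrite /integrand /dintegrand.
have dray e : is_derive u (dlt p) (fun y => P e (ray y t)) (t * pderiv (P e) p (ray u t)).
  have dP := is_C1_differentiable oD (C1P e) Dr.
  have dl : derivable (P e) (ray u t) (t *: dlt p) by exact: diff_derivable.
  have rayE (h : R) : ray (h *: dlt p + u) t = h *: (t *: dlt p) + ray u t.
    by rewrite /ray -addrA scalerDr addrCA scalerA (mulrC t) -scalerA.
  have quotE : (fun h : R => h^-1 *: (((fun y => P e (ray y t)) \o shift u) (h *: dlt p)
      - P e (ray u t))) = (fun h : R => h^-1 *:
      ((P e \o shift (ray u t)) (h *: (t *: dlt p)) - P e (ray u t))).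
    by apply/funext => h; rewrite /= rayE.
  apply: DeriveDef; first by rewrite /derivable quotE.
  rewrite /derive quotE -[LHS]/('D_(t *: dlt p) (P e) (ray u t)).
  by rewrite deriveE// linearZ -deriveE.
have -> : P p (ray u t) + t * \sum_e (u - u0) e.1 e.2 * pderiv (P e) p (ray u t) =
    \sum_e ((u - u0) e.1 e.2 * (t * pderiv (P e) p (ray u t))
            + P e (ray u t) * dlt p e.1 e.2).
  rewrite big_split addrC mulr_sumr; congr (_ + _).
    by apply: eq_bigr => e _; rewrite mulrCA.
  rewrite (bigD1 p)//= mxE !eqxx mulr1 big1 ?addr0// => -[i j] /= ijp.
  rewrite mxE; case: eqP => [ip|]; last by rewrite mulr0.
  case: eqP => [jp|]; last by rewrite mulr0.
  by case/negP: ijp; rewrite ip jp; case: (p).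
apply: is_derive_fct_sum => e; apply: (is_derive_fct_mul _ (dray e)).
have -> : (fun y : E => (y - u0) e.1 e.2) = (fun y : E => y e.1 e.2) + cst (- u0 e.1 e.2).
  by apply/funext => y; rewrite !fctE !mxE.
have dc := is_derive_coord u (dlt p) e.1 e.2.
rewrite -[X in is_derive _ _ _ X]addr0; exact: is_deriveD.
Qed.

Lemma ray_line_continuous (u v : E) :
  continuous (fun z : R * R => ray (u + z.1 *: v) z.2).
Proof.
move=> z; rewrite /ray; apply: cvgD; first exact: cvg_cst.
apply: cvgZ; first exact: cvg_snd.
apply: cvgB; last exact: cvg_cst.
apply: cvgD; first exact: cvg_cst.
by apply: cvgZr_tmp; exact: cvg_fst.
Qed.

Lemma coord_line_continuous (u v : E) e :
  continuous (fun z : R * R => (u + z.1 *: v - u0) e.1 e.2).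
Proof.
have lineE : (fun z : R * R => (u + z.1 *: v - u0) e.1 e.2) =
    (fun z => u e.1 e.2 + z.1 * v e.1 e.2 - u0 e.1 e.2).
  by apply/funext => z; rewrite !mxE.
rewrite lineE => z; apply: cvgB; last exact: cvg_cst.
apply: cvgD; first exact: cvg_cst.
by apply: cvgMr_tmp; exact: cvg_fst.
Qed.

Lemma dintegrand_continuous p (u v : E) (z : R * R) :
  D (ray (u + z.1 *: v) z.2) ->
  {for z, continuous (fun z : R * R => dintegrand p (u + z.1 *: v) z.2)}.
Proof.
move=> Dz; have ray_comp (f : E -> R) : is_Ck 0 D f ->
    {for z, continuous (fun z : R * R => f (ray (u + z.1 *: v) z.2))}.
  move=> Cf; have cf := is_Ck_continuous Cf Dz.
  exact: (continuous_comp (@ray_line_continuous u v z) cf).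
have cP : {for z, continuous (fun z : R * R => P p (ray (u + z.1 *: v) z.2))}.
  exact/ray_comp/(is_Ck_leq (leq0n 1) (C1P p)).
have cS : {for z, continuous (fun z : R * R => \sum_e
    (u + z.1 *: v - u0) e.1 e.2 * pderiv (P e) p (ray (u + z.1 *: v) z.2))}.
  apply: continuous_at_sum => e.
  have [_ /(_ p)/ray_comp cPe] := (is_CkS _ _ _).1 (C1P e).
  exact: (continuousM (@coord_line_continuous u v e z) cPe).
have c2 : {for z, continuous (fun z : R * R => z.2)} by exact: cvg_snd.
exact: (continuousD cP (continuousM c2 cS)).
Qed.

Lemma line_in_near (u v : E) : D u ->
  exists2 r : R, 0 < r & forall s, `|s| <= r -> D (u + s *: v).
Proof.
move=> Du; have lc : {for 0, continuous (fun s : R => u + s *: v)}.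
  by apply: cvgD; [exact: cvg_cst|apply: cvgZr_tmp; exact: cvg_id].
have nD : nbhs (u + 0 *: v) D by rewrite scale0r addr0; exact: open_nbhs_nbhs.
have /nbhs_ballP[r /= r0 rP] := lc _ nD.
(* Halving passes from an open ball to a closed interval, needed for the compactness argument that
   follows. *)
exists (r / 2); first by rewrite divr_gt0.
move=> s sr; apply: rP; rewrite -ball_normE/= sub0r normrN.
by apply: (le_lt_trans sr); rewrite ltr_pdivrMr// ltr_pMr// ltr1n.
Qed.

(** Joint continuity on the compact rectangle [-r, r] x [0, 1] gives a maximum M, the dominating
    constant for differentiation under the integral sign. *)
Lemma dintegrand_bounded p (u : E) : D u -> exists r M : R,
  [/\ 0 < r, 0 <= M & forall s t : R, `|s| <= r -> 0 <= t <= 1 ->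
    D (u + s *: dlt p) /\ `|dintegrand p (u + s *: dlt p) t| <= M].
Proof.
move=> Du; have [r r0 rP] := line_in_near (dlt p) Du.
pose A : set (R * R) := `[- r, r] `*` `[0, 1].
have cA : compact A by apply: compact_setX; exact: segment_compact.
have A0 : A !=set0.
  by exists (0, 0); split; rewrite /= in_itv/= ?lexx ?ler01// oppr_le0 ltW.
have AP z : A z -> `|z.1| <= r /\ 0 <= z.2 <= 1.
  by case=> /=; rewrite !in_itv/= ler_norml.
have cf : {within A, continuous
    (fun z : R * R => `|dintegrand p (u + z.1 *: dlt p) z.2| : R)}.
  apply: continuous_in_subspaceT => z; rewrite inE => /AP[z1 z2].
  have Dz : D (ray (u + z.1 *: dlt p) z.2) by apply: star => //; exact: rP.
  exact: (continuous_comp (dintegrand_continuous Dz) (@norm_continuous _ _ _)).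
have [c _ cP] := compact_EVT_max A0 cA cf.
exists r, `|dintegrand p (u + c.1 *: dlt p) c.2|.
split; [exact: r0|exact: normr_ge0|move=> s t sr t01].
split; first exact: rP.
by apply: (cP (s, t)); rewrite inE; split; rewrite /= in_itv//= -ler_norml.
Qed.

Lemma integrand_continuous u t : D (ray u t) -> {for t, continuous (integrand u)}.
Proof.
move=> Dt; apply: continuous_at_sum => e.
have cP := is_Ck_continuous (C1P e) Dt.
have cr : {for t, continuous (ray u)}.
  by apply: cvgD; [exact: cvg_cst|apply: cvgZr_tmp; exact: cvg_id].
have cc : {for t, continuous (fun _ : R => (u - u0) e.1 e.2)} by exact: cst_continuous.
have cPr : {for t, continuous (fun t : R => P e (ray u t))}.
  exact: (continuous_comp cr cP).
exact: (continuousM cc cPr).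
Qed.

Lemma integrand_integrable u : D u -> mu.-integrable `[0, 1] (EFin \o integrand u).
Proof.
move=> Du; apply: continuous_compact_integrable; first exact: segment_compact.
apply: continuous_in_subspaceT => t; rewrite inE /= in_itv/= => t01.
exact/integrand_continuous/star.
Qed.

(* Closedness turns the differentiated integrand into d/dt (t * P p (ray u t)). *)
Lemma integral_dintegrand p u : D u ->
  \int[mu]_(t in `[0, 1]) dintegrand p u t = P p u.
Proof.
move=> Du; pose phi (t : R) := t * P p (ray u t).
have dphi (t : R) : 0 <= t <= 1 -> is_derive t 1 phi (dintegrand p u t).
  move=> t01; have Dr : D (ray u t) := star Du t01.
  have dP := is_C1_differentiable oD (C1P p) Dr.
  have dl : derivable (P p) (u0 + t *: (u - u0)) (u - u0) by exact: diff_derivable.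
  have dr := is_derive_line dl.
  have -> : dintegrand p u t = t * 'D_(u - u0) (P p) (ray u t) + P p (ray u t) * 1.
    rewrite /dintegrand addrC mulr1 (derive_is_C1 _ oD (C1P p) Dr).
    congr (_ * _ + _); apply: eq_bigr => e _; congr (_ * _).
    exact: closedP.
  exact: is_derive_fct_mul.
have cphi (t : R) : 0 <= t <= 1 -> {for t, continuous phi}.
  move=> /dphi[dt _]; apply: differentiable_continuous.
  exact/derivable1_diffP.
have cd : {within `[0, 1], continuous (dintegrand p u)}.
  apply: continuous_in_subspaceT => t; rewrite inE /= in_itv/= => t01.
  (* Continuity in t alone is the joint continuity restricted to s = 0; the direction u is a
     dummy. *)
  have Dt : D (ray (u + 0 *: u) t) by rewrite scale0r addr0; exact: star.
  have c0 := @dintegrand_continuous p u u (0, t) Dt.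
  have ct : {for t, continuous (fun t : R => (0 : R, t))}.
    exact: (@cvg_pair _ _ _ (nbhs t) (nbhs (0 : R)) (nbhs t) _ _ _
      (fun=> 0) id (cvg_cst _) cvg_id).
  have compE : (fun z : R * R => dintegrand p (u + z.1 *: u) z.2) \o
      (fun s : R => (0, s)) = dintegrand p u.
    by apply/funext => y; rewrite /= scale0r addr0.
  rewrite -compE; exact: (continuous_comp ct c0).
have dcc : derivable_oo_LRcontinuous phi 0 1.
  split.
  - move=> t; rewrite in_itv/= => /andP[t0 t1].
    by have [] := dphi t; rewrite ?(ltW t0) ?(ltW t1).
  - apply: cvg_at_right_filter; by apply: (cphi 0); rewrite lexx ler01.
  - apply: cvg_at_left_filter; by apply: (cphi 1); rewrite lexx ler01.
have phi' : {in `]0, 1[, derive1 phi =1 dintegrand p u}.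
  move=> t; rewrite in_itv/= => /andP[t0 t1]; rewrite derive1E.
  by have [] := dphi t; rewrite ?(ltW t0) ?(ltW t1).
rewrite /Rintegral (continuous_FTC2 ltr01 cd dcc phi').
rewrite -EFinB/= /phi mul0r subr0 mul1r /ray scale1r addrC subrK.
by [].
Qed.

(** On the line u + s [dlt p] this is an integral with one real parameter. Domination by M permits
    differentiating under the integral, and closedness, through [integral_dintegrand], evaluates the
    result. *)
Lemma is_derive_ray_primitive p u : D u ->
  is_derive u (dlt p) ray_primitive (P p u).
Proof.
move=> Du; have [r [M [r0 M0 rMP]]] := dintegrand_bounded p Du.
pose g (s t : R) := integrand (u + s *: dlt p) t.
have sr (s : R) : `]- r, r[%classic s -> `|s| <= r.
  by rewrite /= in_itv/= -ltr_norml => /ltW.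
have t01 (t : R) : `[0, 1]%classic t -> 0 <= t <= 1 by rewrite /= in_itv.
have dg (s t : R) : `]- r, r[%classic s -> `[0, 1]%classic t ->
    is_derive s 1 (g ^~ t) (dintegrand p (u + s *: dlt p) t).
  move=> /sr hs /t01 ht; have [Ds _] := rMP _ _ hs ht.
  have [di <-] := is_derive_ray_integrand p (star Ds ht).
  exact: (is_derive_line di).
have g0 : `]- r, r[%classic (0 : R) by rewrite /= in_itv/= oppr_lt0 r0.
have intg (s : R) : `]- r, r[%classic s -> mu.-integrable `[0, 1] (EFin \o g s).
  move=> /sr hs; apply: integrand_integrable.
  by have [] := rMP s 0 hs _; rewrite ?lexx ?ler01.
have derg (s t : R) : `]- r, r[%classic s -> `[0, 1]%classic t ->
  derivable (g ^~ t) s 1 by move=> hs ht; have [] := dg s t hs ht.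
have d1g (s t : R) : `]- r, r[%classic s -> `[0, 1]%classic t ->
    partial1of2 g s t = dintegrand p (u + s *: dlt p) t.
  by move=> hs ht; rewrite partial1of2E; have [] := dg s t hs ht.
have bd (s t : R) : `]- r, r[%classic s -> `[0, 1]%classic t ->
    `|partial1of2 g s t| <= M.
  move=> hs ht; rewrite d1g//.
  by have [] := rMP s t (sr _ hs) (t01 _ ht).
have intM : mu.-integrable `[0, 1] (EFin \o cst M).
  apply: continuous_compact_integrable; first exact: segment_compact.
  by apply: continuous_subspaceT; exact: cst_continuous.
have cvg := @cvg_differentiation_under_integral R _ _ mu g `[0, 1]
  (measurable_itv _) 0 (- r) r g0 intg derg (cst M) (fun=> M0) intM bd.
have intE : \int[mu]_(t in `[0, 1]) partial1of2 g 0 t = P p u.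
  rewrite -(integral_dintegrand p Du); apply: eq_Rintegral => t; rewrite inE => ht.
  by rewrite (d1g 0 t g0 ht) scale0r addr0.
rewrite {}intE in cvg.
have quotE : (fun h : R => h^-1 *: ((ray_primitive \o shift u) (h *: dlt p)
    - ray_primitive u)) =
  (fun h : R => h^-1 *: (\int[mu]_(t in `[0, 1]) g (h + 0) t
    - \int[mu]_(t in `[0, 1]) g 0 t)).
  apply/funext => h; rewrite /= /ray_primitive /g addr0 scale0r addr0.
  by rewrite (addrC u).
apply: DeriveDef; first by apply/cvg_ex; exists (P p u); rewrite quotE.
by rewrite /derive quotE; exact: cvg_lim.
Qed.

End PoincareLemma.

(* A sealed copy of [partial]: it keeps conversion from unfolding the limit. *)
HB.lock Definition pd (R : realType) (N : nat) (i : 'I_N) (f : 'rV[R]_N -> R) :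
  'rV[R]_N -> R := partial i f.

Lemma partialE (R : realType) (N : nat) : @partial R N = @pd R N.
Proof. by rewrite unlock. Qed.

Section RowVectors.
Variables (R : realType) (N : nat).
Local Notation E := 'rV[R]_N.
Local Notation bas i := (delta_mx ord0 i : E).
Implicit Types (D : set E) (f g : E -> R) (i j k : 'I_N).

Lemma smooth_on_pd D f i : smooth_on D f -> smooth_on D (pd i f).
Proof. by rewrite -partialE; exact: smooth_on_pderiv. Qed.

Lemma pd_eq D f g x i : open D -> (forall u, D u -> f u = g u) -> D x ->
  pd i f x = pd i g x.
Proof.
rewrite -partialE.
by move=> oD fg Dx; apply: (pderiv_eq _ oD) => // u; rewrite inE => /fg.
Qed.

Lemma smooth_is_derive D f x i : smooth_on D f -> D x ->
  is_derive x (bas i) f (pd i f x).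
Proof.
move=> sf Dx; rewrite -partialE; apply: derivableP.
exact: (smooth_on_derivable (e := (ord0, i)) sf Dx).
Qed.

Lemma is_derive_pd f x i d : is_derive x (bas i) f d -> pd i f x = d.
Proof. by rewrite -partialE; case. Qed.

Lemma is_derive_fct_Zl c f x i d : is_derive x (bas i) f d ->
  is_derive x (bas i) (fun y => c * f y) (c * d).
Proof.
move=> df; have := is_derive_fct_mul (is_derive_cst c x (bas i)) df.
by rewrite mulr0 addr0.
Qed.

Lemma pdC D f x i j : open D -> smooth_on D f -> D x ->
  pd i (pd j f) x = pd j (pd i f) x.
Proof.
rewrite -partialE => oD sf Dx.
exact: (schwarz (ord0, j) (ord0, i) oD sf Dx).
Qed.

(** Exchange of the outer and inner indices is what matches the third-derivative terms in both
    closedness conditions of the recursion. *)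
Lemma pd3_sym D f x i j k : open D -> smooth_on D f -> D x ->
  pd i (pd j (pd k f)) x = pd k (pd j (pd i f)) x.
Proof.
move=> oD sf Dx.
rewrite [LHS](pdC i j oD (smooth_on_pd k sf) Dx).
rewrite [RHS](pdC k j oD (smooth_on_pd i sf) Dx).
by apply: (pd_eq _ oD _ Dx) => u Du; exact: pdC oD sf Du.
Qed.

Lemma poincare D u0 (P : 'I_N -> E -> R) : open D ->
  (forall u t, D u -> 0 <= t <= 1 -> D (u0 + t *: (u - u0))) ->
  (forall i, smooth_on D (P i)) ->
  (forall i j x, D x -> pd i (P j) x = pd j (P i) x) ->
  exists F, smooth_on D F /\ forall i x, D x -> pd i F x = P i x.
Proof.
move=> oD star sP; rewrite -partialE => closedP.
pose P' (e : 'I_1 * 'I_N) := P e.2.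
have C1P e : is_Ck 1 D (P' e) by have /smooth_onP := sP e.2; exact.
have closedP' (e1 e2 : 'I_1 * 'I_N) x :
    D x -> pderiv (P' e1) e2 x = pderiv (P' e2) e1 x.
  by case: e1 e2 => [z1 j] [z2 i]; rewrite !ord1 => Dx; exact: closedP.
have dF := is_derive_ray_primitive oD star C1P closedP'.
exists (ray_primitive u0 P'); split.
  exact: (smooth_on_of_partials oD (fun x e Dx => dF e x Dx) (fun e => sP e.2)).
by move=> i x Dx; case: (dF (ord0, i) x Dx).
Qed.

Lemma ball_star (u0 : E) (r : R) u t : ball u0 r u -> 0 <= t <= 1 ->
  ball u0 r (u0 + t *: (u - u0)).
Proof.
rewrite -ball_normE/= => ur /andP[t0 t1].
rewrite opprD addNKr normrN normrZ ger0_norm// distrC.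
by apply: le_lt_trans ur; rewrite ler_piMl.
Qed.

End RowVectors.

(** * Resolvability of the recursion *)

(** Sealed like [pd]. In matrix form, contraction with eta is an associative product, so that the
    first family of equations can be used as a commutation rule. *)
HB.lock Definition hess (R : realType) (N : nat) (f : 'rV[R]_N -> R) (u : 'rV[R]_N) :
  'M[R]_N := \matrix_(i, j) pd i (pd j f) u.

Section Hessian.
Variables (R : realType) (N : nat).
Local Notation E := 'rV[R]_N.
Implicit Types (D : set E) (f g h : E -> R) (i j k : 'I_N).

Lemma hessE f u i j : hess f u i j = pd i (pd j f) u.
Proof. by rewrite unlock mxE. Qed.

Lemma hess_sym D f u : open D -> smooth_on D f -> D u -> (hess f u)^T = hess f u.
Proof.
move=> oD sf Du; apply/matrixP => i j; rewrite mxE [LHS]hessE [RHS]hessE.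
exact: pdC oD sf Du.
Qed.

Lemma mulmx3E (A B C : 'M[R]_N) i l :
  (A *m B *m C) i l = \sum_(j < N) \sum_(k < N) B j k * A i j * C k l.
Proof.
rewrite mxE; under eq_bigr do rewrite mxE big_distrl/=.
by rewrite exchange_big; do 2!apply: eq_bigr => ? _; rewrite (mulrC (A _ _)).
Qed.

Lemma is_derive_quadratic (c : 'M[R]_N) (u : E) r : c^T = c ->
  is_derive u (delta_mx ord0 r)
    (fun v : E => 2^-1 * \sum_(i < N) \sum_(j < N) c i j * v ord0 i * v ord0 j)
    (\sum_(j < N) c r j * u ord0 j).
Proof.
move=> c_sym; have dlt i : (delta_mx ord0 r : E) ord0 i = (i == r)%:R by rewrite mxE eqxx.
(* The right side is the shape produced by the product rule; its two sums coincide by symmetry of c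
   and absorb the factor 1/2. *)
have -> : \sum_(j < N) c r j * u ord0 j = 2^-1 * \sum_(i < N) \sum_(j < N)
    (c i j * u ord0 i * (j == r)%:R + u ord0 j * (c i j * (i == r)%:R)).
  apply/esym; under eq_bigr do rewrite big_split/=.
  have pick (F : 'I_N -> R) : \sum_i F i * (i == r)%:R = F r.
    rewrite (bigD1 r)//= eqxx mulr1 big1 ?addr0// => i /negbTE ->.
    by rewrite mulr0.
  rewrite big_split/=.
  under eq_bigr do rewrite pick.
  under [X in _ + X]eq_bigr => i _.
    under eq_bigr do rewrite mulrA.
    rewrite -mulr_suml; over.
  rewrite pick -[c in X in X + _]c_sym.
  under eq_bigr do rewrite mxE.
  under [X in _ + X]eq_bigr do rewrite mulrC.
  by rewrite -mulr2n -[X in _ * X]mulr_natl mulKf ?pnatr_eq0.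
apply: is_derive_fct_Zl; apply: is_derive_fct_sum => i.
apply: is_derive_fct_sum => j; rewrite -!dlt; apply: is_derive_fct_mul.
  by apply: is_derive_fct_Zl; exact: is_derive_coord.
exact: is_derive_coord.
Qed.

Lemma is_derive_linear_form (c : 'I_N -> R) (u : E) r :
  is_derive u (delta_mx ord0 r) (fun v : E => \sum_(j < N) c j * v ord0 j) (c r).
Proof.
have -> : c r = \sum_(j < N) c j * (delta_mx ord0 r : E) ord0 j.
  rewrite (bigD1 r)//= mxE !eqxx mulr1 big1 ?addr0// => i /negbTE ir.
  by rewrite mxE ir andbF mulr0.
by apply: is_derive_fct_sum => j; apply: is_derive_fct_Zl; exact: is_derive_coord.
Qed.

End Hessian.

Section StepRelations.
Variables (R : realType) (N L : nat).
Variables (eta : 'M[R]_N) (mu : 'M[R]_L) (psi : 'I_L -> 'rV[R]_N -> R).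
Variables (V : set 'rV[R]_N) (h : 'rV[R]_N -> R) (F : 'I_L -> 'rV[R]_N -> R).

Lemma F_stepE : F_step eta psi V h F = forall (n : 'I_L) (p : 'I_N) u, V u ->
  \sum_(j < N) \sum_(r < N) pd j (pd p (psi n)) u * eta j r * pd r h u
  = pd p (F n) u.
Proof. by rewrite /F_step /partial2 partialE. Qed.

Lemma h_stepE : h_step mu psi V F h = forall (j k : 'I_N) u, V u ->
  \sum_(m < L) \sum_(n < L) mu m n * pd j (pd k (psi m)) u * F n u
  = pd j (pd k h) u.
Proof. by rewrite /h_step /partial2 partialE. Qed.

End StepRelations.

Section Resolvability.
Variables (R : realType) (N L : nat).
Variables (eta : 'M[R]_N) (mu : 'M[R]_L) (psi : 'I_L -> 'rV[R]_N -> R).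
Local Notation E := 'rV[R]_N.
Variable D : set E.
Hypothesis eta_sym : eta^T = eta.
Hypothesis eta_unit : eta \in unitmx.
Hypothesis oD : open D.
Hypothesis psi_smooth : forall n, smooth_on D (psi n).
Hypothesis psi_assoc : forall (i l : 'I_N) (j k : 'I_L) (u : 'rV[R]_N), D u ->
     \sum_(m < N) \sum_(n < N)
       eta m n * pd i (pd m (psi j)) u * pd n (pd l (psi k)) u
     = \sum_(m < N) \sum_(n < N)
       eta m n * pd i (pd m (psi k)) u * pd n (pd l (psi j)) u.
Hypothesis psi_gauss : forall (i j k l : 'I_N) (u : 'rV[R]_N), D u ->
     \sum_(m < L) \sum_(n < L)
       mu m n * pd i (pd j (psi m)) u * pd k (pd l (psi n)) u
     = \sum_(m < L) \sum_(n < L)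
       mu m n * pd i (pd k (psi m)) u * pd j (pd l (psi n)) u.

Lemma psi_assoc_mx j k u : D u ->
  hess (psi j) u *m eta *m hess (psi k) u = hess (psi k) u *m eta *m hess (psi j) u.
Proof.
move=> Du; apply/matrixP => i l; rewrite [LHS]mulmx3E [RHS]mulmx3E.
apply: etrans (etrans (psi_assoc i l j k Du) _); last first.
  by apply: eq_bigr => a _; apply: eq_bigr => b _; rewrite hessE;
  congr (_ * _); rewrite hessE.
by apply: eq_bigr => a _; apply: eq_bigr => b _; rewrite hessE;
  congr (_ * _); rewrite hessE.
Qed.

(* This commutation is the closedness condition for the forms dF_n. *)
Definition hess_commutes (h : E -> R) : Prop := forall n u, D u ->
  hess (psi n) u *m eta *m hess h u = hess h u *m eta *m hess (psi n) u.

Lemma quadratic_pd (h : E -> R) :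
  (forall u, D u -> h u = 2^-1 * \sum_(i < N) \sum_(j < N)
                invmx eta i j * u ord0 i * u ord0 j) ->
  forall r u, D u -> pd r h u = \sum_(j < N) invmx eta r j * u ord0 j.
Proof.
move=> hE r u Du; rewrite (pd_eq _ oD hE Du); apply: is_derive_pd.
by apply: is_derive_quadratic; rewrite trmx_inv eta_sym.
Qed.

Lemma quadratic_hess (h : E -> R) :
  (forall u, D u -> h u = 2^-1 * \sum_(i < N) \sum_(j < N)
                invmx eta i j * u ord0 i * u ord0 j) ->
  forall u, D u -> hess h u = invmx eta.
Proof.
move=> hE u Du; apply/matrixP => i j; rewrite hessE.
rewrite (pd_eq _ oD (quadratic_pd hE j) Du).
rewrite (is_derive_pd (is_derive_linear_form _ _ _)).
by rewrite -[in RHS]eta_sym -trmx_inv mxE.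
Qed.

Lemma quadratic_smooth (h : E -> R) :
  (forall u, D u -> h u = 2^-1 * \sum_(i < N) \sum_(j < N)
                invmx eta i j * u ord0 i * u ord0 j) ->
  smooth_on D h.
Proof.
move=> hE; apply: (@smooth_on_eq _ _ _ _ (fun u : E => 2^-1 *
    \sum_(i < N) \sum_(j < N) invmx eta i j * u ord0 i * u ord0 j)) => //.
  by move=> u; rewrite inE => /hE.
apply: smooth_onZ => //; apply: smooth_on_sum => // i.
apply: smooth_on_sum => // j.
exact: (smooth_onM oD (smooth_onZ _ oD (smooth_on_coord _ _ oD))
          (smooth_on_coord _ _ oD)).
Qed.

Lemma quadratic_hess_commutes (h : E -> R) :
  (forall u, D u -> h u = 2^-1 * \sum_(i < N) \sum_(j < N)
                invmx eta i j * u ord0 i * u ord0 j) ->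
  hess_commutes h.
Proof.
move=> hE n u Du; rewrite (quadratic_hess hE Du).
by rewrite -mulmxA mulmxV// mulVmx// mulmx1 mul1mx.
Qed.

Lemma h_step_hess (F : 'I_L -> E -> R) (h : E -> R) u : h_step mu psi D F h -> D u ->
  hess h u = \sum_(m < L) \sum_(n < L) (mu m n * F n u) *: hess (psi m) u.
Proof.
rewrite h_stepE => hF Du; apply/matrixP => j k; rewrite hessE -hF// summxE.
apply: eq_bigr => m _; rewrite summxE; apply: eq_bigr => n _.
by rewrite mxE hessE mulrAC.
Qed.

(** Commutation is linear in the Hessian of h, pointwise in u, so the coefficients mu^{mn} F_n may
    be any functions and the constants of integration in F do no harm. *)
Lemma h_step_hess_commutes (F : 'I_L -> E -> R) (h : E -> R) :
  h_step mu psi D F h -> hess_commutes h.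
Proof.
move=> hF n u Du; rewrite (h_step_hess hF Du) mulmx_sumr !mulmx_suml.
apply: eq_bigr => m _; rewrite mulmx_sumr !mulmx_suml; apply: eq_bigr => l _.
by rewrite -scalemxAr -!scalemxAl psi_assoc_mx.
Qed.

Section StarShaped.
Variable u0 : E.
Hypothesis star : forall (u : E) (t : R), D u -> 0 <= t <= 1 ->
  D (u0 + t *: (u - u0)).

Lemma F_step_exists (h : E -> R) : smooth_on D h -> hess_commutes h ->
  exists F : 'I_L -> E -> R,
    (forall n, smooth_on D (F n)) /\ F_step eta psi D h F.
Proof.
move=> sh ch.
suff Fn n : exists F : E -> R, smooth_on D F /\ forall p u, D u -> pd p F u =
    \sum_(j < N) \sum_(r < N) eta j r * (pd j (pd p (psi n)) u * pd r h u).
  have [F FP] := choice Fn; exists F; rewrite F_stepE; split=> [n|n p u Du].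
    by have [] := FP n.
  have [_ ->//] := FP n; apply: eq_bigr => j _; apply: eq_bigr => r _.
  by rewrite mulrA (mulrC (eta _ _)).
apply: (poincare oD star) => [p|q p x Dx].
  apply: (smooth_on_sum oD) => j; apply: (smooth_on_sum oD) => r.
  have sp := smooth_on_pd j (smooth_on_pd p (psi_smooth n)).
  exact: (smooth_onZ _ oD (smooth_onM oD sp (smooth_on_pd r sh))).
(* The third-derivative part is symmetric in a and b; closedness is thereby reduced to symmetry of
   the matrix H(psi_n) eta H(h). *)
have dP a b : pd a (fun u => \sum_(j < N) \sum_(r < N)
      eta j r * (pd j (pd b (psi n)) u * pd r h u)) x =
    \sum_(j < N) \sum_(r < N)
      eta j r * (pd r h x * pd a (pd j (pd b (psi n))) x) +
    (hess (psi n) x *m eta *m hess h x) b a.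
  rewrite mulmx3E -big_split/=.
  under [RHS]eq_bigr do rewrite -big_split/=.
  apply: is_derive_pd; apply: is_derive_fct_sum => j.
  apply: is_derive_fct_sum => r.
  have -> : eta j r * (pd r h x * pd a (pd j (pd b (psi n))) x) +
      eta j r * hess (psi n) x b j * hess h x r a =
      eta j r * (pd j (pd b (psi n)) x * pd a (pd r h) x +
         pd r h x * pd a (pd j (pd b (psi n))) x).
    rewrite hessE (hessE h) (pdC b j oD (psi_smooth n) Dx) (pdC r a oD sh Dx).
    by ring.
  have sp := smooth_on_pd j (smooth_on_pd b (psi_smooth n)).
  exact: (is_derive_fct_Zl _ (is_derive_fct_mul (smooth_is_derive a sp Dx)
    (smooth_is_derive a (smooth_on_pd r sh) Dx))).
rewrite !dP; congr (_ + _).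
  apply: eq_bigr => j _; apply: eq_bigr => r _.
  by rewrite (pd3_sym _ _ _ oD (psi_smooth n) Dx).
(* Transposition reverses a product of symmetric matrices, and the commutation hypothesis restores
   the order. *)
have X_sym : (hess (psi n) x *m eta *m hess h x)^T = hess (psi n) x *m eta *m hess h x.
  rewrite !trmx_mul eta_sym (hess_sym oD sh Dx) (hess_sym oD (psi_smooth n) Dx).
  by rewrite mulmxA ch.
by rewrite -[in LHS]X_sym mxE.
Qed.

(** T is the prescribed Hessian. Each of its rows is a closed form with primitive g_j, and the g_j
    are in turn the components of a closed form. *)
Lemma h_step_exists (h : E -> R) (F : 'I_L -> E -> R) :
  (forall n, smooth_on D (F n)) -> F_step eta psi D h F ->
  exists h', smooth_on D h' /\ h_step mu psi D F h'.
Proof.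
move=> sF; rewrite F_stepE => FP.
pose T j k (u : E) := \sum_(m < L) \sum_(n < L)
  mu m n * (pd j (pd k (psi m)) u * F n u).
have sT j k : smooth_on D (T j k).
  apply: (smooth_on_sum oD) => m; apply: (smooth_on_sum oD) => n.
  have sp := smooth_on_pd j (smooth_on_pd k (psi_smooth m)).
  exact: (smooth_onZ _ oD (smooth_onM oD sp (sF n))).
have Tsym j k u : D u -> T j k u = T k j u.
  move=> Du; apply: eq_bigr => m _; apply: eq_bigr => n _.
  by rewrite (pdC j k oD (psi_smooth m) Du).
(* The derivatives of F are replaced by their defining equation, which makes products of two Hessian
   entries of psi appear; the second family of equations exchanges k and l in them. *)
have dT j k l x : D x -> pd l (T j k) x = 
    \sum_(m < L) \sum_(n < L) mu m n * (F n x * pd l (pd j (pd k (psi m))) x) +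
    \sum_(a < N) \sum_(r < N) eta a r * pd r h x * 
      (\sum_(m < L) \sum_(n < L)
         mu m n * pd j (pd k (psi m)) x * pd l (pd a (psi n)) x).
  move=> Dx.
  have -> : \sum_(a < N) \sum_(r < N) eta a r * pd r h x * 
      (\sum_(m < L) \sum_(n < L)
         mu m n * pd j (pd k (psi m)) x * pd l (pd a (psi n)) x) =
      \sum_(m < L) \sum_(n < L) mu m n * pd j (pd k (psi m)) x * pd l (F n) x.
    under eq_bigr do under eq_bigr do rewrite big_distrr/=.
    under eq_bigr do rewrite exchange_big/=.
    rewrite exchange_big/=; apply: eq_bigr => m _.
    under eq_bigr do under eq_bigr do rewrite big_distrr/=.
    under eq_bigr do rewrite exchange_big/=.
    rewrite exchange_big/=; apply: eq_bigr => n _.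
    rewrite -FP// big_distrr/=; apply: eq_bigr => a _.
    rewrite big_distrr/=; apply: eq_bigr => r _.
    rewrite (pdC l a oD (psi_smooth n) Dx); ring.
  rewrite -big_split/=; under [RHS]eq_bigr do rewrite -big_split/=.
  apply: is_derive_pd; apply: is_derive_fct_sum => m.
  apply: is_derive_fct_sum => n.
  rewrite addrC -mulrA -mulrDr.
  have sp := smooth_on_pd j (smooth_on_pd k (psi_smooth m)).
  exact: (is_derive_fct_Zl _ (is_derive_fct_mul (smooth_is_derive l sp Dx)
    (smooth_is_derive l (sF n) Dx))).
have gP j : exists g, smooth_on D g /\ forall k x, D x -> pd k g x = T j k x.
  apply: (poincare oD star) => [//|k l x Dx].
  rewrite !dT//; congr (_ + _).
    apply: eq_bigr => m _; apply: eq_bigr => n _.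
    by rewrite (pd3_sym _ _ _ oD (psi_smooth m) Dx) //.
  by apply: eq_bigr => a _; apply: eq_bigr => r _; rewrite psi_gauss.
have [g {}gP] := choice gP.
(* Closedness of the form with components g_k is the symmetry of T. *)
have [h' [sh' h'P]] : exists h', smooth_on D h' /\
    forall k x, D x -> pd k h' x = g k x.
  apply: (poincare oD star) => [j|i j x Dx]; first by have [] := gP j.
  have [_ ->//] := gP j; have [_ ->//] := gP i; exact: Tsym.
exists h'; rewrite h_stepE; split => // j k u Du.
rewrite (pd_eq _ oD (h'P k) Du); have [_ ->//] := gP k.
rewrite Tsym//; apply: eq_bigr => m _; apply: eq_bigr => n _.
by rewrite mulrA.
Qed.

End StarShaped.
End Resolvability.

(** * Iterating the recursion step on one fixed domain *)

Section Resolution.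
Variables (R : realType) (N L : nat).
Variables (eta : 'M[R]_N) (mu : 'M[R]_L) (psi : 'I_L -> 'rV[R]_N -> R).
Local Notation E := 'rV[R]_N.
Implicit Types (V W : set E) (h : nat -> E -> R) (F : nat -> 'I_L -> E -> R).

Lemma F_stepW V W (g : E -> R) (G : 'I_L -> E -> R) : W `<=` V ->
  F_step eta psi V g G -> F_step eta psi W g G.
Proof. by move=> WV GP n p u /WV; exact: GP. Qed.

Lemma h_stepW V W (G : 'I_L -> E -> R) (g : E -> R) : W `<=` V ->
  h_step mu psi V G g -> h_step mu psi W G g.
Proof. by move=> WV GP j k u /WV; exact: GP. Qed.

Lemma resolved_uptoW V W s h F : W `<=` V ->
  resolved_upto eta mu psi V s h F -> resolved_upto eta mu psi W s h F.
Proof.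
move=> WV [h1 hF]; split=> [u /WV|t ts]; first exact: h1.
have [sF FP sh hP] := hF t ts.
split=> [n|||]; [exact: smooth_onW (sF n)|exact: F_stepW FP|exact: smooth_onW sh|].
exact: h_stepW hP.
Qed.

Section OnDomain.
Variable D : set E.
Hypothesis eta_sym : eta^T = eta.
Hypothesis eta_unit : eta \in unitmx.
Hypothesis oD : open D.
Hypothesis psi_smooth : forall n, smooth_on D (psi n).
Hypothesis psi_assoc : forall (i l : 'I_N) (j k : 'I_L) (u : 'rV[R]_N), D u ->
     \sum_(m < N) \sum_(n < N)
       eta m n * pd i (pd m (psi j)) u * pd n (pd l (psi k)) u
     = \sum_(m < N) \sum_(n < N)
       eta m n * pd i (pd m (psi k)) u * pd n (pd l (psi j)) u.

Lemma resolved_upto_smooth s h F : (1 <= s)%N ->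
  resolved_upto eta mu psi D s h F -> smooth_on D (h s).
Proof.
case: s => [//|[|s]] _ [h1 hF]; first exact: (quadratic_smooth oD h1).
by have [_ _] := hF s.+1 (ltnSn _).
Qed.

Lemma resolved_upto_hess_commutes s h F : (1 <= s)%N ->
  resolved_upto eta mu psi D s h F -> hess_commutes eta psi D (h s).
Proof.
case: s => [//|[|s]] _ [h1 hF].
  exact: (quadratic_hess_commutes psi eta_sym eta_unit oD h1).
have [_ _ _] := hF s.+1 (ltnSn _).
exact: h_step_hess_commutes.
Qed.

Variable u0 : E.
Hypothesis star : forall (u : E) (t : R), D u -> 0 <= t <= 1 ->
  D (u0 + t *: (u - u0)).
Hypothesis psi_gauss : forall (i j k l : 'I_N) (u : 'rV[R]_N), D u ->
     \sum_(m < L) \sum_(n < L)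
       mu m n * pd i (pd j (psi m)) u * pd k (pd l (psi n)) u
     = \sum_(m < L) \sum_(n < L)
       mu m n * pd i (pd k (psi m)) u * pd j (pd l (psi n)) u.

(** Infinitely many purely local steps could shrink the neighbourhood to a point. Here every step
    stays on D, since its output again satisfies the invariant, and the functions already chosen are
    kept. *)
Lemma resolution_extends s h F : (1 <= s)%N -> resolved_upto eta mu psi D s h F ->
  exists (h' : nat -> E -> R) (F' : nat -> 'I_L -> E -> R),
    [/\ forall t, (1 <= t <= s)%N -> h' t = h t,
        forall t, (1 <= t < s)%N -> F' t = F t
      & resolved eta mu psi D h' F'].
Proof.
move=> s1 hF.
have step (g : E -> R) : exists X : ('I_L -> E -> R) * (E -> R),
    smooth_on D g -> hess_commutes eta psi D g ->
    [/\ forall n, smooth_on D (X.1 n), F_step eta psi D g X.1,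
        smooth_on D X.2 & h_step mu psi D X.1 X.2].
  (* Off the invariant any value will do; it only serves to make the step total, so that [choice]
     gives a function to iterate. *)
  have [[sg cg]|ng] := pselect (smooth_on D g /\ hess_commutes eta psi D g); last first.
    by exists (fun=> g, g) => sg cg; case: ng.
  have [G [sG GP]] := F_step_exists eta_sym oD psi_smooth star sg cg.
  have [g' [sg' g'P]] := h_step_exists oD psi_smooth psi_gauss star sG GP.
  exists (G, g') => _ _; exact: And4 sG GP sg' g'P.
have [next nextP] := choice step.
(* [hk k] plays the role of h_(s+k); the matching F^(s+k) is the first component of
   [next (hk k)]. *)
pose hk k := iter k (fun g => (next g).2) (h s).
have hkP k : smooth_on D (hk k) /\ hess_commutes eta psi D (hk k).
  elim: k => [|k [sk ck]].
    by split; [exact: resolved_upto_smooth hF|exact: resolved_upto_hess_commutes hF].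
  have [_ _ sk' hP] := nextP (hk k) sk ck.
  by split=> //; exact: h_step_hess_commutes hP.
exists (fun t => if (t <= s)%N then h t else hk (t - s)%N).
exists (fun t => if (t < s)%N then F t else (next (hk (t - s)%N)).1).
split=> [t /andP[_ ->]//|t /andP[_ ->]//|]; split.
  by rewrite /h_init s1; case: hF.
move=> t t1; have [ts|st] := ltnP t s.
  rewrite /recursion_step (ltnW ts) ts.
  by have [_ /(_ t)] := hF; rewrite t1 ts; apply.
have [sk ck] := hkP (t - s)%N.
have [sF FP sh hP] := nextP _ sk ck.
rewrite /recursion_step [(t < s)%N]ltnNge st /= subSn//.
(* The two branches overlap only at t = s, where [hk 0] is [h s]. *)
have -> : (if (t <= s)%N then h t else hk (t - s)%N) = hk (t - s)%N.
  case: ifP => // ts; have -> : t = s by apply/eqP; rewrite eqn_leq ts.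
  by rewrite subnn.
by split.
Qed.

End OnDomain.

Lemma locally_in_ball V (Q : set E -> Prop) : open V ->
  (forall u0 r, 0 < r -> ball u0 r `<=` V -> Q (ball u0 r)) -> locally_in V Q.
Proof.
move=> oV QP u0 Vu0.
have /nbhs_ballP[r /= r0 rV] := open_nbhs_nbhs (conj oV Vu0).
exists (ball u0 r); split => //; [exact: ball_open|exact: ballxx|exact: QP].
Qed.

End Resolution.

(** * Flows and brackets *)

Section JetCalculus.
Variables (R : realType) (N : nat).
Local Notation E := 'rV[R]_N.
Local Notation jet := (jet R N).
Implicit Types (D : set E) (f g : E -> R) (z : jet) (i j k l : 'I_N).

Lemma fsbig_nat_ltn (n : nat) (F : nat -> R) : (forall k : nat, (n <= k)%N -> F k = 0) ->
  \sum_(k \in [set: nat]) F k = \sum_(k < n) F k.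
Proof.
move=> F0; rewrite -(big_mkord xpredT F) /index_iota subn0.
rewrite (fsbigE (iota 0 n)) ?iota_uniq//; last first.
  by move=> k _; rewrite mem_iota add0n /= -leqNgt => nk; exact (F0 k nk).
by rewrite big_mkcond; apply: eq_bigr => k _; rewrite in_setT.
Qed.

Lemma djet0_of_fields f i z : djet 0 i (of_fields f) z = pd i f (z 0%N).
Proof.
rewrite -partialE /djet /of_fields /partial /pderiv /derive1 /derive.
have quotE : (fun h : R => h^-1 *: (f (jet_shift z 0 i (h + 0) 0%N)
    - f (jet_shift z 0 i 0 0%N))) = (fun h : R => h^-1 *:
    ((f \o shift (z 0%N)) (h *: delta_mx ord0 i) - f (z 0%N))).
  by apply/funext => h; rewrite /jet_shift /= scale0r !addr0 (addrC (z 0%N)).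
by rewrite quotE.
Qed.

Lemma djetS_of_fields f n i : djet n.+1 i (of_fields f) = fun=> 0.
Proof. by apply/funext => z; rewrite /djet /of_fields /jet_shift/= derive1_cst. Qed.

Lemma Dx_of_fields f z :
  Dx (of_fields f) z = \sum_i z 1%N ord0 i * pd i f (z 0%N).
Proof.
rewrite /Dx (@fsbig_nat_ltn 1) => [|[//|k] _].
  by rewrite big_ord1; apply: eq_bigr => i _; rewrite djet0_of_fields.
by rewrite big1// => i _; rewrite djetS_of_fields mulr0.
Qed.

Lemma Dx_eq0 : Dx (fun _ : jet => 0) = fun=> 0 :> R.
Proof.
apply/funext => z; rewrite /Dx fsbig1// => k _.
by rewrite big1// => i _; rewrite /djet derive1_cst mulr0.
Qed.

Lemma vard_of_fields f i : vard (of_fields f) i = of_fields (pd i f).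
Proof.
apply/funext => z; rewrite /vard (@fsbig_nat_ltn 1) => [|[//|k] _].
  by rewrite big_ord1 expr0 mul1r /= djet0_of_fields.
rewrite djetS_of_fields; have -> : iter k.+1 (@Dx R N) (fun=> 0) = fun=> 0.
  by elim: k => [|k IH]; rewrite iterS ?IH /= Dx_eq0.
by rewrite mulr0.
Qed.

(** All antiderivatives of the hierarchy are functions of u alone, so each choice of (d/dx)^{-1} is
    certified by an identity for a gradient contracted with u_x. *)
Lemma antider_of_fields D f (q : jet -> R) : smooth_on D f ->
  (forall z, D (z 0%N) -> \sum_i z 1%N ord0 i * pd i f (z 0%N) = q z) ->
  antider D q (of_fields f).
Proof.
move=> sf fq; split=> [|z Dz]; last by rewrite Dx_of_fields fq.
exists 0%N, f; split=> [es M|z Dz]; first by rewrite /= row_id; exact: sf.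
by congr f; apply/rowP => i; rewrite mxE.
Qed.

(** One component of a system of hydrodynamic type. Only the jet coordinates u and u_x occur, which
    cuts the sums in [Dx] and [evol] to two terms. *)
Definition hydro (a : 'I_N -> E -> R) : jet -> R :=
  fun z => \sum_k a k (z 0%N) * z 1%N ord0 k.

Lemma is_derive1_line (f : R -> R) (x d : R) : is_derive x 1 f d -> derive1 f x = d.
Proof. by rewrite derive1E; case. Qed.

Lemma djet0_hydro D a j z : (forall k, smooth_on D (a k)) -> D (z 0%N) ->
  djet 0 j (hydro a) z = \sum_k pd j (a k) (z 0%N) * z 1%N ord0 k.
Proof.
move=> sa Dz; apply: is_derive1_line.
apply: is_derive_fct_sum => k.
rewrite /jet_shift /=.
have dz : derivable (a k) (z 0%N + (0 : R) *: delta_mx ord0 j) (delta_mx ord0 j).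
  rewrite scale0r addr0.
  exact: (smooth_on_derivable (e := (ord0, j)) (sa k) Dz).
have := is_derive_line dz; rewrite scale0r addr0.
have [_ ->] := smooth_is_derive j (sa k) Dz.
move=> da; rewrite mulrC; under eq_fun do rewrite mulrC.
have := is_derive_fct_mul (is_derive_cst (z 1%N ord0 k) (0 : R) 1) da.
by rewrite mulr0 addr0.
Qed.

Lemma djet1_hydro a j z : djet 1 j (hydro a) z = a j (z 0%N).
Proof.
apply: is_derive1_line; rewrite /hydro /jet_shift /=.
have -> : a j (z 0%N) = \sum_k a k (z 0%N) * (k == j)%:R.
  rewrite (bigD1 j)//= eqxx mulr1 big1 ?addr0// => k /negbTE ->.
  by rewrite mulr0.
apply: is_derive_fct_sum => k.
have -> : (fun t : R => a k (z 0%N) * (z 1%N + t *: delta_mx ord0 j) ord0 k) =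
    (fun t : R => a k (z 0%N) * (z 1%N ord0 k + t * (k == j)%:R)).
  by apply/funext => t; rewrite !mxE eqxx.
have dt : is_derive (0 : R) 1 (fun t : R => z 1%N ord0 k + t * (k == j)%:R) (k == j)%:R.
  have d1 := is_derive_fct_mul (is_derive_id (0 : R) (1 : R))
    (is_derive_cst ((k == j)%:R : R) (0 : R) 1).
  have := is_deriveD (is_derive_cst (z 1%N ord0 k) (0 : R) 1) d1.
  by rewrite mulr0 !add0r mulr1.
have := is_derive_fct_mul (is_derive_cst (a k (z 0%N)) (0 : R) 1) dt.
by rewrite mulr0 addr0.
Qed.

Lemma djetSS_hydro a n j z : djet n.+2 j (hydro a) z = 0.
Proof. by rewrite /djet /hydro /jet_shift/= derive1_cst. Qed.

Lemma Dx_hydro D a z : (forall k, smooth_on D (a k)) -> D (z 0%N) ->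
  Dx (hydro a) z = \sum_j z 1%N ord0 j * (\sum_k pd j (a k) (z 0%N) * z 1%N ord0 k)
    + \sum_j z 2%N ord0 j * a j (z 0%N).
Proof.
move=> sa Dz; rewrite /Dx (@fsbig_nat_ltn 2) => [|[|[|k]]//= _]; last first.
  by rewrite big1// => j _; rewrite djetSS_hydro mulr0.
rewrite big_ord_recl big_ord1 /=; congr (_ + _); apply: eq_bigr => j _.
  by rewrite (djet0_hydro _ sa Dz).
by rewrite djet1_hydro.
Qed.

Lemma evol_hydro D (w : 'I_N -> jet -> R) a z :
  (forall k, smooth_on D (a k)) -> D (z 0%N) ->
  evol w (hydro a) z = \sum_j w j z * (\sum_k pd j (a k) (z 0%N) * z 1%N ord0 k)
    + \sum_j Dx (w j) z * a j (z 0%N).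
Proof.
move=> sa Dz; rewrite /evol (@fsbig_nat_ltn 2) => [|[|[|k]]//= _]; last first.
  by rewrite big1// => j _; rewrite djetSS_hydro mulr0.
rewrite big_ord_recl big_ord1 /=; congr (_ + _); apply: eq_bigr => j _.
  by rewrite (djet0_hydro _ sa Dz).
by rewrite djet1_hydro.
Qed.

End JetCalculus.

(** * Commutation of systems of hydrodynamic type *)

Section CommutingFlows.
Variables (R : realType) (N : nat).
Local Notation E := 'rV[R]_N.
Local Notation jet := (jet R N).

(* With A j = a_ij, B j l = b_jl, x = u_x and y = u_xx, the left side is the
   derivative of a_ik u^k_x along u^j_t = b_jl u^l_x; the right side depends only
   on the product of the matrices a and b. *)
Lemma sum_mixed_derivative (A x y : 'I_N -> R) (B dA : 'I_N -> 'I_N -> R)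
    (dB : 'I_N -> 'I_N -> 'I_N -> R) : (forall j k, dA j k = dA k j) ->
  \sum_j (\sum_l B j l * x l) * (\sum_k dA j k * x k)
  + \sum_j (\sum_m x m * (\sum_l dB m j l * x l) + \sum_m y m * B j m) * A j
  = \sum_m \sum_l x m * x l * (\sum_j (A j * dB m j l + B j l * dA m j))
    + \sum_l y l * (\sum_j A j * B j l).
Proof.
move=> dA_sym.
have -> : \sum_j (\sum_l B j l * x l) * (\sum_k dA j k * x k) =
    \sum_m \sum_l \sum_j x m * x l * (B j l * dA m j).
  under eq_bigr do rewrite mulrC mulr_suml.
  rewrite exchange_big; apply: eq_bigr => m _.
  under eq_bigr do rewrite mulr_sumr.
  rewrite exchange_big; apply: eq_bigr => l _.
  by apply: eq_bigr => j _; rewrite dA_sym; ring.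
under [X in _ + X = _]eq_bigr do rewrite mulrDl.
rewrite big_split/= addrA; congr (_ + _).
  have -> : \sum_j (\sum_m x m * (\sum_l dB m j l * x l)) * A j =
      \sum_m \sum_l \sum_j x m * x l * (A j * dB m j l).
    under eq_bigr do rewrite mulr_suml.
    rewrite exchange_big; apply: eq_bigr => m _.
    under eq_bigr do rewrite -mulrA mulr_suml mulr_sumr.
    rewrite exchange_big; apply: eq_bigr => l _.
    by apply: eq_bigr => j _; ring.
  rewrite -big_split/=; apply: eq_bigr => m _.
  rewrite -big_split/=; apply: eq_bigr => l _.
  rewrite -big_split/= mulr_sumr; apply: eq_bigr => j _; ring.
under eq_bigr do rewrite mulr_suml.
rewrite exchange_big; apply: eq_bigr => l _.
by rewrite mulr_sumr; apply: eq_bigr => j _; ring.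
Qed.

(** Closedness of the row a lets the derivatives of a and of b combine, by the product rule, into
    the derivative of the row a b. Only the matrix product survives, so commutation of matrices
    suffices for the flows. *)
Lemma evol_hydro_hydro (D : set E) (a : 'I_N -> E -> R) (b : 'I_N -> 'I_N -> E -> R) z :
  (forall k, smooth_on D (a k)) -> (forall j k, smooth_on D (b j k)) ->
  (forall j k u, D u -> pd j (a k) u = pd k (a j) u) -> D (z 0%N) ->
  evol (fun j => hydro (b j)) (hydro a) z =
    \sum_m \sum_l z 1%N ord0 m * z 1%N ord0 l *
      pd m (fun u => \sum_j a j u * b j l u) (z 0%N)
    + \sum_l z 2%N ord0 l * (\sum_j a j (z 0%N) * b j l (z 0%N)).
Proof.
move=> sa sb a_closed Dz; rewrite (evol_hydro _ sa Dz).
under [X in _ + X = _]eq_bigr do rewrite (Dx_hydro (sb _) Dz).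
rewrite /hydro (sum_mixed_derivative (fun j => a j (z 0%N)) _ _
  (fun j k => b j k (z 0%N)) (fun m j l => pd m (b j l) (z 0%N))); last first.
  by move=> j k; exact: a_closed.
congr (_ + _); apply: eq_bigr => m _; apply: eq_bigr => l _; congr (_ * _).
apply/esym/is_derive_pd; apply: is_derive_fct_sum => j.
exact: (is_derive_fct_mul (smooth_is_derive m (sa j) Dz)
  (smooth_is_derive m (sb j l) Dz)).
Qed.

Lemma flows_commute_hydro (D : set E) (a b : 'I_N -> 'I_N -> E -> R) : open D ->
  (forall i k, smooth_on D (a i k)) -> (forall i k, smooth_on D (b i k)) ->
  (forall i j k u, D u -> pd j (a i k) u = pd k (a i j) u) ->
  (forall i j k u, D u -> pd j (b i k) u = pd k (b i j) u) ->
  (forall i l u, D u -> \sum_j a i j u * b j l u = \sum_j b i j u * a j l u) ->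
  flows_commute D (fun i => hydro (a i)) (fun i => hydro (b i)).
Proof.
move=> oD sa sb a_closed b_closed ab i z Dz.
rewrite (evol_hydro_hydro (sa i) sb (a_closed i) Dz).
rewrite (evol_hydro_hydro (sb i) sa (b_closed i) Dz); congr (_ + _).
  apply: eq_bigr => m _; apply: eq_bigr => l _; congr (_ * _).
  by apply: (pd_eq _ oD _ Dz) => u Du; exact: ab.
by apply: eq_bigr => l _; rewrite ab.
Qed.

End CommutingFlows.

(** * Flows, Hamiltonian structures and involution for a resolved recursion *)

Section ResolvedHierarchy.
Variables (R : realType) (N L : nat).
Variables (eta : 'M[R]_N) (mu : 'M[R]_L) (psi : 'I_L -> 'rV[R]_N -> R).
Local Notation E := 'rV[R]_N.
Local Notation jet := (jet R N).
Variables (V : set E) (h : nat -> E -> R) (F : nat -> 'I_L -> E -> R).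
Hypothesis eta_sym : eta^T = eta.
Hypothesis eta_unit : eta \in unitmx.
Hypothesis mu_sym : mu^T = mu.
Hypothesis oV : open V.
Hypothesis psi_smooth : forall n, smooth_on V (psi n).
Hypothesis psi_assoc : forall (i l : 'I_N) (j k : 'I_L) (u : 'rV[R]_N), V u ->
     \sum_(m < N) \sum_(n < N)
       eta m n * pd i (pd m (psi j)) u * pd n (pd l (psi k)) u
     = \sum_(m < N) \sum_(n < N)
       eta m n * pd i (pd m (psi k)) u * pd n (pd l (psi j)) u.
Hypothesis hF : resolved eta mu psi V h F.

Lemma resolved_smooth s : (1 <= s)%N -> smooth_on V (h s).
Proof.
move=> s1; apply: (resolved_upto_smooth oV s1 (mu := mu) (F := F) (psi := psi)).
have [h1 hP] := hF; split; first exact: h1.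
by move=> t /andP[t1 _]; exact: hP.
Qed.

Lemma resolved_smooth_F s n : (1 <= s)%N -> smooth_on V (F s n).
Proof. by move=> s1; have [_ /(_ s s1)[sF _ _ _]] := hF; exact: sF. Qed.

Lemma resolved_pdF s n p u : (1 <= s)%N -> V u -> pd p (F s n) u =
  \sum_(j < N) \sum_(r < N) pd j (pd p (psi n)) u * eta j r * pd r (h s) u.
Proof.
by move=> s1 Vu; have [_ /(_ s s1)[_ FP _ _]] := hF; move: FP; rewrite F_stepE => ->.
Qed.

Lemma resolved_pdh s j k u : (1 <= s)%N -> V u -> pd j (pd k (h s.+1)) u =
  \sum_(m < L) \sum_(n < L) mu m n * pd j (pd k (psi m)) u * F s n u.
Proof.
by move=> s1 Vu; have [_ /(_ s s1)[_ _ _ hP]] := hF; move: hP; rewrite h_stepE => ->.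
Qed.

Lemma resolved_hess1 u : V u -> hess (h 1%N) u = invmx eta.
Proof. by have [h1 _] := hF; exact: (quadratic_hess eta_sym oV h1). Qed.

(** Written through F, so that [flow] is [hydro] of it as a function on all jets; equality with eta
    H(h_(s+1)) is available only on V. *)
Definition flow_coef (s : nat) (i k : 'I_N) (u : E) : R :=
  \sum_p eta i p * \sum_m \sum_n mu m n * (pd p (pd k (psi m)) u * F s n u).

Definition flow_potential (s : nat) (i : 'I_N) (u : E) : R :=
  \sum_p eta i p * pd p (h s.+1) u.

Lemma flow_hydro s i : flow eta mu psi F s i = hydro (flow_coef s i).
Proof.
apply/funext => z; rewrite /flow /hydro /flow_coef /partial2 partialE /ux.
under [RHS]eq_bigr do rewrite mulr_suml.
rewrite [RHS]exchange_big/= (eq_bigr (fun m => \sum_(p < N) \sum_(n < L) \sum_(k < N)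
    mu m n * eta i p * F s n (z 0%N) * pd p (pd k (psi m)) (z 0%N) * z 1%N ord0 k)).
  rewrite exchange_big/=; apply: eq_bigr => p _.
  under eq_bigr do rewrite exchange_big/=.
  rewrite exchange_big/=; apply: eq_bigr => k _.
  rewrite mulr_sumr mulr_suml; apply: eq_bigr => m _.
  rewrite mulr_sumr mulr_suml; apply: eq_bigr => n _; ring.
by move=> m _; rewrite exchange_big.
Qed.

Lemma flow_coef_hess s i k u : (1 <= s)%N -> V u ->
  flow_coef s i k u = (eta *m hess (h s.+1) u) i k.
Proof.
move=> s1 Vu; rewrite mxE; apply: eq_bigr => p _; congr (_ * _).
rewrite hessE (resolved_pdh _ _ s1 Vu); apply: eq_bigr => m _.
by apply: eq_bigr => n _; rewrite mulrA.
Qed.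

Lemma flow_coef_smooth s i k : (1 <= s)%N -> smooth_on V (flow_coef s i k).
Proof.
move=> s1; apply: (smooth_on_sum oV) => p; apply: (smooth_onZ _ oV).
apply: (smooth_on_sum oV) => m; apply: (smooth_on_sum oV) => n.
have sp := smooth_on_pd p (smooth_on_pd k (psi_smooth m)).
exact: (smooth_onZ _ oV (smooth_onM oV sp (resolved_smooth_F n s1))).
Qed.

Lemma is_derive_eta_grad s i k u : (1 <= s)%N -> V u ->
  is_derive u (delta_mx ord0 k) (fun v => \sum_r eta i r * pd r (h s) v)
    ((eta *m hess (h s) u) i k).
Proof.
move=> s1 Vu; have sh := resolved_smooth s1.
rewrite mxE; apply: is_derive_fct_sum => r; apply: is_derive_fct_Zl.
rewrite hessE (pdC r k oV sh Vu).
exact: (smooth_is_derive k (smooth_on_pd r sh) Vu).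
Qed.

Lemma flow_coef_pd s i k u : (1 <= s)%N -> V u ->
  flow_coef s i k u = pd k (flow_potential s i) u.
Proof.
move=> s1 Vu; rewrite (flow_coef_hess _ _ s1 Vu); apply/esym/is_derive_pd.
exact: is_derive_eta_grad.
Qed.

Lemma flow_potential_smooth s i : smooth_on V (flow_potential s i).
Proof.
apply: (smooth_on_sum oV) => p; apply: (smooth_onZ _ oV).
by apply: smooth_on_pd; exact: resolved_smooth.
Qed.

Lemma flow_coef_closed s i j k u : (1 <= s)%N -> V u ->
  pd j (flow_coef s i k) u = pd k (flow_coef s i j) u.
Proof.
move=> s1 Vu.
rewrite (pd_eq j oV (fun v Vv => flow_coef_pd i k s1 Vv) Vu).
rewrite (pd_eq k oV (fun v Vv => flow_coef_pd i j s1 Vv) Vu).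
exact: (pdC j k oV (flow_potential_smooth s i) Vu).
Qed.

(** It is enough to expand H(h_(r+1)) into the H(psi_m), each of which commutes with H(h_(s+1))
    through eta. *)
Lemma hess_hess_commute r s u : (1 <= r)%N -> (1 <= s)%N -> V u ->
  hess (h r.+1) u *m eta *m hess (h s.+1) u =
  hess (h s.+1) u *m eta *m hess (h r.+1) u.
Proof.
move=> r1 s1 Vu; have [_ /(_ r r1)[_ _ _ rP]] := hF.
have [_ /(_ s s1)[_ _ _ sP]] := hF.
have cs := h_step_hess_commutes psi_assoc sP.
rewrite (h_step_hess rP Vu) mulmx_sumr !mulmx_suml.
apply: eq_bigr => m _; rewrite mulmx_sumr !mulmx_suml; apply: eq_bigr => n _.
by rewrite -scalemxAr -!scalemxAl cs.
Qed.

Lemma flows_commute_hierarchy r s : (1 <= r)%N -> (1 <= s)%N ->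
  flows_commute V (flow eta mu psi F r) (flow eta mu psi F s).
Proof.
move=> r1 s1.
have -> : flow eta mu psi F r = fun i => hydro (flow_coef r i).
  by apply/funext => i; exact: flow_hydro.
have -> : flow eta mu psi F s = fun i => hydro (flow_coef s i).
  by apply/funext => i; exact: flow_hydro.
apply: (flows_commute_hydro oV) => [i k|i k|i j k u Vu|i j k u Vu|i l u Vu].
- exact: flow_coef_smooth.
- exact: flow_coef_smooth.
- exact: flow_coef_closed.
- exact: flow_coef_closed.
have prodE a b : (1 <= a)%N -> (1 <= b)%N ->
    \sum_j flow_coef a i j u * flow_coef b j l u =
    (eta *m (hess (h a.+1) u *m eta *m hess (h b.+1) u)) i l.
  move=> a1 b1; rewrite -mulmxA mulmxA mxE; apply: eq_bigr => j _.
  by rewrite (flow_coef_hess _ _ a1 Vu) (flow_coef_hess _ _ b1 Vu).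
by rewrite (prodE r s r1 s1) (prodE s r s1 r1) hess_hess_commute.
Qed.

Lemma Dx_A_of s j z : (1 <= s)%N -> V (z 0%N) ->
  Dx (A_of eta h s j) z = \sum_k (eta *m hess (h s) (z 0%N)) j k * z 1%N ord0 k.
Proof.
move=> s1 Vz; rewrite /A_of partialE Dx_of_fields; apply: eq_bigr => k _.
by rewrite (is_derive_pd (is_derive_eta_grad j k s1 Vz)) mulrC.
Qed.

Lemma antider_A_of s j v : (1 <= s)%N ->
  (forall z, V (z 0%N) -> Dx (A_of eta h s j) z = v z) -> antider V v (A_of eta h s j).
Proof.
move=> s1 dA; apply: antider_of_fields => [|z Vz].
  rewrite partialE; apply: (smooth_on_sum oV) => r; apply: (smooth_onZ _ oV).
  by apply: smooth_on_pd; exact: resolved_smooth.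
by rewrite -dA// Dx_of_fields.
Qed.

Lemma flow_M1_form (G : 'I_L -> jet -> R) s i z : G = G_of F s ->
  flow eta mu psi F s i z = \sum_(m < L) \sum_(n < L) \sum_(p < N) \sum_(k < N)
    mu m n * eta i p * partial2 p k (psi m) (z 0%N) * ux k z * G n z.
Proof.
move=> ->; rewrite /flow /partial2 partialE /G_of /of_fields.
do 4!apply: eq_bigr => ? _; ring.
Qed.

(** One application of R. The input v is left general so that the same statement covers v = u_x when
    s = 1 and the preceding flow when s > 1. *)
Lemma R_rel_flow s (v : 'I_N -> jet -> R) : (1 <= s)%N ->
  (forall j z, V (z 0%N) -> Dx (A_of eta h s j) z = v j z) ->
  R_rel eta mu psi V (A_of eta h s) (G_of F s) v (flow eta mu psi F s).
Proof.
move=> s1 dA; split=> [j|n|i z Vz]; first by apply: antider_A_of => // z; exact: dA.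
  apply: antider_of_fields => [|z Vz]; first exact: resolved_smooth_F.
  rewrite /A_of /partial2 partialE /of_fields /ux.
  under eq_bigr => p _.
    rewrite (resolved_pdF _ _ s1 Vz) mulr_sumr.
    under eq_bigr do rewrite mulr_sumr.
    over.
  rewrite exchange_big/=; apply: eq_bigr => j _; apply: eq_bigr => p _.
  rewrite mulr_sumr; apply: eq_bigr => r _; ring.
exact: flow_M1_form.
Qed.

Lemma R_power_flow s : (1 <= s)%N ->
  R_power eta mu psi V (A_of eta h) (G_of F) s (flow eta mu psi F s).
Proof.
(* Induction starts at the first power, where D_x A_1 = u_x because eta H(h_1) is the identity;
   later, D_x A_(s+1) is the s-th flow. *)
case: s => // s _; elim: s => [|s IH].
  exists (@ux R N); split=> //; apply: R_rel_flow => // j z Vz.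
  rewrite Dx_A_of// resolved_hess1// mulmxV// /ux (bigD1 j)//= mxE eqxx mul1r.
  rewrite big1 ?addr0// => k /negbTE kj; by rewrite mxE eq_sym kj mul0r.
exists (flow eta mu psi F s.+1); split=> //; apply: R_rel_flow => // j z Vz.
rewrite Dx_A_of// flow_hydro; apply: eq_bigr => k _.
by rewrite (flow_coef_hess _ _ _ Vz).
Qed.

(** The equation defining F^(s), contracted with u_x, states that the nonlocal integrand of M_1 at
    dh_s is D_x F^(s)_n; symmetry of eta aligns the indices. *)
Lemma M1_rel_flow s : (1 <= s)%N ->
  M1_rel eta mu psi V (G_of F s) (vard (of_fields (h s))) (flow eta mu psi F s).
Proof.
move=> s1; split=> [n|i z Vz]; last exact: flow_M1_form.
apply: antider_of_fields => [|z Vz]; first exact: resolved_smooth_F.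
rewrite /partial2 partialE /ux.
under eq_bigr => p _.
  rewrite (resolved_pdF _ _ s1 Vz) mulr_sumr.
  under eq_bigr do rewrite mulr_sumr.
  over.
rewrite exchange_big/=; under eq_bigr do rewrite exchange_big/=.
rewrite exchange_big/=; apply: eq_bigr => r _; apply: eq_bigr => j _.
apply: eq_bigr => p _; rewrite vard_of_fields /of_fields.
by rewrite -[in LHS]eta_sym mxE; ring.
Qed.

Lemma sum_eta_Dx_vard s i z : (1 <= s)%N -> V (z 0%N) ->
  \sum_(j < N) eta i j * Dx (vard (of_fields (h s)) j) z =
  \sum_k (eta *m hess (h s) (z 0%N)) i k * z 1%N ord0 k.
Proof.
move=> s1 Vz; under [RHS]eq_bigr do rewrite mxE mulr_suml.
rewrite exchange_big/=; apply: eq_bigr => j _.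
rewrite vard_of_fields Dx_of_fields mulr_sumr; apply: eq_bigr => k _.
rewrite hessE (pdC j k oV (resolved_smooth s1) Vz); ring.
Qed.

Lemma M2_rel_flow s : (1 <= s)%N ->
  M2_rel eta V (vard (of_fields (h s.+1))) (flow eta mu psi F s).
Proof.
move=> s1 i z Vz; rewrite sum_eta_Dx_vard// flow_hydro; apply: eq_bigr => k _.
by rewrite (flow_coef_hess _ _ s1 Vz).
Qed.

(* The density of {H_p, H_r}_2 is the contraction of this form with u_x; that of
   {H_p, H_r}_1 corresponds to the form with r.+1 in place of r. *)
Definition bracket_form (p r : nat) (k : 'I_N) (u : E) : R :=
  \sum_i \sum_j eta i j * (pd i (h p) u * pd k (pd j (h r)) u).

Definition bracket_exact (p r : nat) : Prop :=
  exists Q : E -> R, smooth_on V Q /\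
    forall k u, V u -> pd k Q u = bracket_form p r k u.

(** H_1 is the momentum of the second bracket: M_2 sends its gradient to u_x, since eta H(h_1) is
    the identity. The form is then dh_p. *)
Lemma bracket_exact1 p : (1 <= p)%N -> bracket_exact p 1.
Proof.
move=> p1; exists (h p); split; first exact: resolved_smooth.
move=> k u Vu.
have inner i : \sum_j eta i j * (pd i (h p) u * pd k (pd j (h 1%N)) u) =
    pd i (h p) u * (i == k)%:R.
  have <- : (eta *m hess (h 1%N) u) i k = (i == k)%:R.
    by rewrite (resolved_hess1 Vu) mulmxV// mxE.
  rewrite mxE mulr_sumr; apply: eq_bigr => j _.
  rewrite hessE (pdC j k oV (resolved_smooth (leqnn 1)) Vu); ring.
rewrite /bracket_form; under eq_bigr do rewrite inner.
rewrite (bigD1 k)//= eqxx mulr1 big1 ?addr0// => i /negbTE ->.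
by rewrite mulr0.
Qed.

(* Skew-symmetry of the second bracket: the two forms add up to the
   differential of eta (dh_p, dh_r). *)
Lemma bracket_exact_swap p r : (1 <= p)%N -> (1 <= r)%N ->
  bracket_exact p r -> bracket_exact r p.
Proof.
move=> p1 r1 [Q [sQ QP]].
have sp i := smooth_on_pd i (resolved_smooth p1).
have sr j := smooth_on_pd j (resolved_smooth r1).
pose W u := \sum_i \sum_j eta i j * (pd i (h p) u * pd j (h r) u) + (-1) * Q u.
exists W; split.
  apply: (smooth_onD oV); last exact: (smooth_onZ _ oV sQ).
  apply: (smooth_on_sum oV) => i; apply: (smooth_on_sum oV) => j.
  exact: (smooth_onZ _ oV (smooth_onM oV (sp i) (sr j))).
move=> k u Vu.
have -> : bracket_form r p k u = \sum_i \sum_j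
    eta i j * (pd i (h p) u * pd k (pd j (h r)) u + pd j (h r) u * pd k (pd i (h p)) u)
    + (-1) * pd k Q u.
  rewrite QP// /bracket_form.
  under [X in _ = X + _]eq_bigr do under eq_bigr do rewrite mulrDr.
  under [X in _ = X + _]eq_bigr do rewrite big_split/=.
  rewrite [X in _ = X + _]big_split/= mulN1r addrAC subrr add0r exchange_big/=.
  apply: eq_bigr => i _; apply: eq_bigr => j _.
  by rewrite -[in LHS]eta_sym mxE.
apply: is_derive_pd; apply: is_deriveD; last first.
  exact: (is_derive_fct_Zl _ (smooth_is_derive k sQ Vu)).
apply: is_derive_fct_sum => i; apply: is_derive_fct_sum => j.
exact: (is_derive_fct_Zl _ (is_derive_fct_mul (smooth_is_derive k (sp i) Vu)
  (smooth_is_derive k (sr j) Vu))).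
Qed.

(** The first bracket in terms of F: the Hessian of h_(r+1) contributes F^(r), and what remains of
    its psi-factor, contracted with eta and dh_p, is dF^(p). *)
Lemma bracket_formS p r k u : (1 <= p)%N -> (1 <= r)%N -> V u ->
  bracket_form p r.+1 k u =
  \sum_m \sum_n mu m n * (pd k (F p m) u * F r n u).
Proof.
move=> p1 r1 Vu; rewrite /bracket_form.
under eq_bigr => i _.
  under eq_bigr => j _.
    rewrite (resolved_pdh _ _ r1 Vu) !mulr_sumr.
    under eq_bigr do rewrite !mulr_sumr.
    over.
  rewrite exchange_big/=.
  under eq_bigr do rewrite exchange_big/=.
  over.
rewrite exchange_big/=; apply: eq_bigr => m _.
rewrite exchange_big/=; apply: eq_bigr => n _.
rewrite (resolved_pdF _ _ p1 Vu) [in RHS]exchange_big/= mulr_suml mulr_sumr.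
apply: eq_bigr => i _; rewrite mulr_suml mulr_sumr; apply: eq_bigr => j _.
rewrite (pdC j k oV (psi_smooth m) Vu) -[in LHS]eta_sym mxE; ring.
Qed.

(* Skew-symmetry of the first bracket: the two forms add up to the
   differential of mu (F^(p), F^(r)). *)
Lemma bracket_exact_shift p r : (1 <= p)%N -> (1 <= r)%N ->
  bracket_exact p r.+1 -> bracket_exact r p.+1.
Proof.
move=> p1 r1 [Q [sQ QP]].
have sp n := resolved_smooth_F n p1.
have sr n := resolved_smooth_F n r1.
pose W u := \sum_m \sum_n mu m n * (F p m u * F r n u) + (-1) * Q u.
exists W; split.
  apply: (smooth_onD oV); last exact: (smooth_onZ _ oV sQ).
  apply: (smooth_on_sum oV) => m; apply: (smooth_on_sum oV) => n.
  exact: (smooth_onZ _ oV (smooth_onM oV (sp m) (sr n))).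
move=> k u Vu.
have -> : bracket_form r p.+1 k u = \sum_m \sum_n
    mu m n * (F p m u * pd k (F r n) u + F r n u * pd k (F p m) u)
    + (-1) * pd k Q u.
  rewrite QP// (bracket_formS _ p1 r1 Vu) (bracket_formS _ r1 p1 Vu).
  under [X in _ = X + _]eq_bigr do under eq_bigr do rewrite mulrDr.
  under [X in _ = X + _]eq_bigr do rewrite big_split/=.
  rewrite [X in _ = X + _]big_split/= mulN1r.
  under [X in _ = _ + X + _]eq_bigr do under eq_bigr do rewrite (mulrC (F r _ u)).
  rewrite addrK exchange_big/=; apply: eq_bigr => m _; apply: eq_bigr => n _.
  by rewrite -[in LHS]mu_sym mxE; congr (_ * _); rewrite mulrC.
apply: is_derive_pd; apply: is_deriveD; last first.
  exact: (is_derive_fct_Zl _ (smooth_is_derive k sQ Vu)).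
apply: is_derive_fct_sum => m; apply: is_derive_fct_sum => n.
exact: (is_derive_fct_Zl _ (is_derive_fct_mul (smooth_is_derive k (sp m) Vu)
  (smooth_is_derive k (sr n) Vu))).
Qed.

(* Lenard scheme: {H_p, H_(r+1)}_2 is equivalent to {H_(p+1), H_r}_2. *)
Lemma bracket_exact_all p r : (1 <= p)%N -> (1 <= r)%N -> bracket_exact p r.
Proof.
move=> + r1; elim: r r1 p => // -[|r] IH _ p p1; first exact: bracket_exact1.
(* The pair (p, r+2) is reached by the shift from (r+1, p+1), and that by the swap from (p+1, r+1).
   The second index drops by one while p grows, so p stays general in the induction. *)
apply: (bracket_exact_shift (ltn0Sn r) p1).
by apply: (bracket_exact_swap (ltn0Sn p) (ltn0Sn r)); exact: IH.
Qed.

(** An exact form contracted with u_x is D_x of its primitive. *)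
Lemma null_functional_bracket p r (K : jet -> R) : (1 <= p)%N -> (1 <= r)%N ->
  (forall z, V (z 0%N) -> K z = \sum_(i < N) vard (of_fields (h p)) i z *
     \sum_(j < N) eta i j * Dx (vard (of_fields (h r)) j) z) ->
  null_functional V K.
Proof.
move=> p1 r1 KE; have [Q [sQ QP]] := bracket_exact_all p1 r1.
exists (of_fields Q); apply: antider_of_fields => // z Vz; rewrite KE//.
under eq_bigr do rewrite QP// /bracket_form mulr_sumr.
rewrite exchange_big/=; apply: eq_bigr => i _.
rewrite vard_of_fields /of_fields.
under eq_bigr do rewrite mulr_sumr.
rewrite exchange_big/= mulr_sumr; apply: eq_bigr => j _.
rewrite vard_of_fields Dx_of_fields !mulr_sumr; apply: eq_bigr => k _; ring.
Qed.

Lemma involution_M1 p r : (1 <= p)%N -> (1 <= r)%N -> exists K,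
  bracket_density V (M1_rel eta mu psi V (G_of F r))
    (of_fields (h p)) (of_fields (h r)) K /\ null_functional V K.
Proof.
move=> p1 r1; exists (fun z => \sum_(i < N) vard (of_fields (h p)) i z *
  flow eta mu psi F r i z); split.
  by exists (flow eta mu psi F r); split; first exact: M1_rel_flow.
(* The r-th flow is also M_2 applied to the gradient of H_(r+1), so the density is that of {H_p,
   H_(r+1)}_2. *)
apply: (null_functional_bracket p1 (ltn0Sn r)) => z Vz.
by apply: eq_bigr => i _; rewrite (M2_rel_flow r1 i Vz).
Qed.

Lemma involution_M2 p r : (1 <= p)%N -> (1 <= r)%N -> exists K,
  bracket_density V (M2_rel eta V) (of_fields (h p)) (of_fields (h r)) K /\
  null_functional V K.
Proof.
move=> p1 r1; pose w (i : 'I_N) z := \sum_(j < N) eta i j *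
  Dx (vard (of_fields (h r)) j) z.
exists (fun z => \sum_(i < N) vard (of_fields (h p)) i z * w i z); split.
  by exists w; split.
exact: (null_functional_bracket p1 r1).
Qed.

End ResolvedHierarchy.

Theorem mainTheorem5 (R : realType) (N L : nat)
  (eta : 'M[R]_N) (mu : 'M[R]_L)
  (U : set 'rV[R]_N) (psi : 'I_L -> 'rV[R]_N -> R)
  (eta_sym : eta^T = eta) (eta_nondeg : eta \in unitmx)
  (mu_sym : mu^T = mu) (mu_nondeg : mu \in unitmx)
  (U_open : open U)
  (psi_smooth : forall n, smooth_on U (psi n))
  (psi_assoc : forall (i l : 'I_N) (j k : 'I_L) (u : 'rV[R]_N), U u ->
     \sum_(m < N) \sum_(n < N)
       eta m n * partial2 i m (psi j) u * partial2 n l (psi k) u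
     = \sum_(m < N) \sum_(n < N)
       eta m n * partial2 i m (psi k) u * partial2 n l (psi j) u)
  (psi_gauss : forall (i j k l : 'I_N) (u : 'rV[R]_N), U u ->
     \sum_(m < L) \sum_(n < L)
       mu m n * partial2 i j (psi m) u * partial2 k l (psi n) u
     = \sum_(m < L) \sum_(n < L)
       mu m n * partial2 i k (psi m) u * partial2 j l (psi n) u) :
  (* local resolvability of the recursion, whatever choices have been made *)
  (forall (V : set 'rV[R]_N) (s : nat) (h : nat -> 'rV[R]_N -> R)
      (F : nat -> 'I_L -> 'rV[R]_N -> R),
     open V -> V `<=` U -> (1 <= s)%N ->
     resolved_upto eta mu psi V s h F ->
     [/\ locally_in V (fun W => exists Fs : 'I_L -> 'rV[R]_N -> R,
           (forall n, smooth_on W (Fs n)) /\ F_step eta psi W (h s) Fs),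
         (forall Fs : 'I_L -> 'rV[R]_N -> R,
            (forall n, smooth_on V (Fs n)) -> F_step eta psi V (h s) Fs ->
            locally_in V (fun W => exists hs1 : 'rV[R]_N -> R,
              smooth_on W hs1 /\ h_step mu psi W Fs hs1))
       & locally_in V (fun W =>
           exists (h' : nat -> 'rV[R]_N -> R)
                  (F' : nat -> 'I_L -> 'rV[R]_N -> R),
             [/\ forall t, (1 <= t <= s)%N -> h' t = h t,
                 forall t, (1 <= t < s)%N -> F' t = F t
               & resolved eta mu psi W h' F'])])
  /\
  (* the resulting hierarchy *)
  (forall (V : set 'rV[R]_N) (h : nat -> 'rV[R]_N -> R)
      (F : nat -> 'I_L -> 'rV[R]_N -> R),
     open V -> V `<=` U -> resolved eta mu psi V h F ->
     [/\ forall s, (1 <= s)%N ->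
           R_power eta mu psi V (A_of eta h) (G_of F) s (flow eta mu psi F s),
         forall r s, (1 <= r)%N -> (1 <= s)%N ->
           flows_commute V (flow eta mu psi F r) (flow eta mu psi F s),
         forall s, (1 <= s)%N ->
           M1_rel eta mu psi V (G_of F s)
             (vard (of_fields (h s))) (flow eta mu psi F s) /\
           M2_rel eta V
             (vard (of_fields (h s.+1))) (flow eta mu psi F s)
       & forall p r, (1 <= p)%N -> (1 <= r)%N ->
           (exists K,
              bracket_density V (M1_rel eta mu psi V (G_of F r))
                (of_fields (h p)) (of_fields (h r)) K /\
              null_functional V K) /\
           (exists K,
              bracket_density V (M2_rel eta V)
                (of_fields (h p)) (of_fields (h r)) K /\
              null_functional V K)]).
Proof.
have assoc (V : set 'rV[R]_N) : V `<=` U ->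
    forall (i l : 'I_N) (j k : 'I_L) (u : 'rV[R]_N), V u ->
    \sum_(m < N) \sum_(n < N)
      eta m n * pd i (pd m (psi j)) u * pd n (pd l (psi k)) u
    = \sum_(m < N) \sum_(n < N)
      eta m n * pd i (pd m (psi k)) u * pd n (pd l (psi j)) u.
  move=> VU i l j k u /VU Uu; move: psi_assoc; rewrite /partial2 partialE.
  exact.
have gauss (V : set 'rV[R]_N) : V `<=` U ->
    forall (i j k l : 'I_N) (u : 'rV[R]_N), V u ->
    \sum_(m < L) \sum_(n < L)
      mu m n * pd i (pd j (psi m)) u * pd k (pd l (psi n)) u
    = \sum_(m < L) \sum_(n < L)
      mu m n * pd i (pd k (psi m)) u * pd j (pd l (psi n)) u.
  move=> VU i j k l u /VU Uu; move: psi_gauss; rewrite /partial2 partialE.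
  exact.
have psiV (V : set 'rV[R]_N) : V `<=` U -> forall n, smooth_on V (psi n).
  by move=> VU n; exact: smooth_onW VU (psi_smooth n).
split=> [V s h F oV VU s1 hF|V h F oV VU hF].
  split.
  - apply: (locally_in_ball oV) => u0 r r0 BV.
    have oB : open (ball u0 r) := ball_open u0 r; have BU := subset_trans BV VU.
    have hB := resolved_uptoW BV hF.
    apply: (F_step_exists eta_sym oB (psiV _ BU) (@ball_star R N u0 r)).
      exact: (resolved_upto_smooth oB s1 hB).
    exact: (resolved_upto_hess_commutes eta_sym eta_nondeg oB (assoc _ BU) s1 hB).
  - move=> Fs sF FP; apply: (locally_in_ball oV) => u0 r r0 BV.
    have oB : open (ball u0 r) := ball_open u0 r; have BU := subset_trans BV VU.
    apply: (h_step_exists oB (psiV _ BU) (gauss _ BU) (@ball_star R N u0 r)).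
      by move=> n; exact: smooth_onW BV (sF n).
    exact: F_stepW BV FP.
  apply: (locally_in_ball oV) => u0 r r0 BV.
  have oB : open (ball u0 r) := ball_open u0 r; have BU := subset_trans BV VU.
  exact: (resolution_extends eta_sym eta_nondeg oB (psiV _ BU) (assoc _ BU)
    (@ball_star R N u0 r) (gauss _ BU) s1 (resolved_uptoW BV hF)).
split=> [s s1|r s r1 s1|s s1|p r p1 r1].
- exact: (R_power_flow eta_sym eta_nondeg oV hF s1).
- exact: (flows_commute_hierarchy oV (psiV _ VU) (assoc _ VU) hF r1 s1).
- split; first exact: (M1_rel_flow eta_sym hF s1).
  exact: (M2_rel_flow oV hF s1).
split.
  exact: (involution_M1 eta_sym eta_nondeg mu_sym oV (psiV _ VU) hF p1 r1).
exact: (involution_M2 eta_sym eta_nondeg mu_sym oV (psiV _ VU) hF p1 r1).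
Qed.
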